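(* Let $0<\alpha<1$ and set $\lambda=\pi(1-\alpha)/2$. Let $b\in\mathbb{C}$, let $n\ge 1$ be an integer, and let $f_{b,n}(z)=z+b\bar z^{\,n}$ for $z\in\mathbb{D}$. Then the following are equivalent: (i) $f_{b,n}\in\mathcal{SS}_{\mathrm{H}}(\alpha)$; (ii) $f_{b,n}\in\mathcal{SP}_{\mathrm{H}}(\lambda)$; (iii) $|b|\le C_n(\alpha)$, where $$C_n(\alpha)=\frac{2\sin(\pi\alpha/2)}{n+1+|n+e^{i\pi\alpha}|}.$$
   Context: $\mathbb{D}=\{z\in\mathbb{C}:|z|<1\}$ and $\mathbb{D}_r=\{z:|z|<r\}$. $\mathcal{H}_0$ is the class of complex-valued harmonic functions $f$ on $\mathbb{D}$ with $f(0)=0$ and $f_z(0)=1$. Orientation-preserving means that the Jacobian $J_f=|f_z|^2-|f_{\bar z}|^2$ is positive on $\mathbb{D}$; univalent means injective. For a real $\lambda$ with $|\lambda|<\pi/2$ and $w_0\in\mathbb{C}\setminus\{0\}$, put $[0,w_0]_\lambda=\{w_0\exp(te^{i\lambda}):t\le 0\}\cup\{0\}$. A domain $\Omega\subset\mathbb{C}$ is called $\lambda$-spirallike if $[0,w]_\lambda\subset\Omega$ for all $w\in\Omega$, $w\neq0$. The class $\mathcal{SP}_{\mathrm{H}}(\lambda)$ of hereditarily $\lambda$-spirallike functions consists of those $f\in\mathcal{H}_0$ which are orientation-preserving and univalent on $\mathbb{D}$ and such that $f(\mathbb{D}_r)$ is $\lambda$-spirallike for each $0<r<1$. For $0<\alpha<1$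 put $\tau=\tan(\pi\alpha/2)$ and let $V_\alpha$ be the Jordan domain bounded by the two logarithmic spiral segments $\{e^{(-\tau+i)\theta}:0\le\theta\le\pi\}$ and $\{e^{(\tau+i)\theta}:-\pi\le\theta\le 0\}$. Set $w_0V_\alpha=\{w_0w:w\in V_\alpha\}$. A domain $\Omega\subset\mathbb{C}$ is called strongly starlike of order $\alpha$ (with respect to the origin) if $w_0V_\alpha\subset\Omega$ for all $w_0\in\Omega$. The class $\mathcal{SS}_{\mathrm{H}}(\alpha)$ of hereditarily strongly starlike functions of order $\alpha$ consists of those $f\in\mathcal{H}_0$ which are orientation-preserving and univalent on $\mathbb{D}$ and such that $f(\mathbb{D}_r)$ is a strongly starlike domain of order $\alpha$ for each $0<r<1$. *)

(* Defs.v *)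
From Stdlib Require Import Reals.
From Coquelicot Require Import Coquelicot.
Open Scope R_scope.

Definition connected (A : C -> Prop) : Prop :=
  forall U V : C -> Prop, open U -> open V ->
    (forall z, A z -> U z \/ V z) ->
    (exists z, A z /\ U z) -> (exists z, A z /\ V z) ->
    exists z, A z /\ U z /\ V z.

Definition domain (A : C -> Prop) : Prop :=
  (exists z, A z) /\ open A /\ connected A.

Definition component (A : C -> Prop) (w z : C) : Prop :=
  exists B : C -> Prop,
    connected B /\ (forall x, B x -> A x) /\ B w /\ B z.

Definition Cbounded (A : C -> Prop) : Prop :=
  exists M : R, forall z, A z -> Cmod z <= M.

(* The union of the bounded components of the complement of [Gamma]; when
   [Gamma] is a Jordan curve there is exactly one such component. *)
Definition jordan_domain (Gamma : C -> Prop) (w : C) : Prop :=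
  ~ Gamma w /\ Cbounded (component (fun z => ~ Gamma z) w).

Definition disk (r : R) (z : C) : Prop := Cmod z < r.

Definition image (f : C -> C) (A : C -> Prop) (w : C) : Prop :=
  exists z, A z /\ w = f z.

Definition Cexp (z : C) : C :=
  (exp (Re z) * cos (Im z), exp (Re z) * sin (Im z)).

(* [Derive] is total, so the existence of the partial derivatives is part of
   [C1_on]. *)
Definition partial_x (u : C -> R) (z : C) : R :=
  Derive (fun t => u (t, Im z)) (Re z).
Definition partial_y (u : C -> R) (z : C) : R :=
  Derive (fun t => u (Re z, t)) (Im z).

Definition C1_on (D : C -> Prop) (u : C -> R) : Prop :=
  forall z, D z ->
    ex_derive (fun t => u (t, Im z)) (Re z) /\
    ex_derive (fun t => u (Re z, t)) (Im z) /\
    continuous (partial_x u) z /\ continuous (partial_y u) z.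

Definition C2_on (D : C -> Prop) (u : C -> R) : Prop :=
  C1_on D u /\ C1_on D (partial_x u) /\ C1_on D (partial_y u).

Definition real_harmonic_on (D : C -> Prop) (u : C -> R) : Prop :=
  C2_on D u /\
  forall z, D z ->
    partial_x (partial_x u) z + partial_y (partial_y u) z = 0.

Definition harmonic_on (D : C -> Prop) (f : C -> C) : Prop :=
  real_harmonic_on D (fun z => Re (f z)) /\
  real_harmonic_on D (fun z => Im (f z)).

Definition f_x (f : C -> C) (z : C) : C :=
  (partial_x (fun w => Re (f w)) z, partial_x (fun w => Im (f w)) z).
Definition f_y (f : C -> C) (z : C) : C :=
  (partial_y (fun w => Re (f w)) z, partial_y (fun w => Im (f w)) z).

Definition f_z (f : C -> C) (z : C) : C := ((f_x f z - Ci * f_y f z) / 2)%C.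
Definition f_zbar (f : C -> C) (z : C) : C := ((f_x f z + Ci * f_y f z) / 2)%C.

Definition jacobian (f : C -> C) (z : C) : R :=
  Cmod (f_z f z) ^ 2 - Cmod (f_zbar f z) ^ 2.

(* Functions on the unit disk are represented by total functions on [C], of
   which only the values on the disk matter. *)
Definition class_H0 (f : C -> C) : Prop :=
  harmonic_on (disk 1) f /\ f 0%C = 0%C /\ f_z f 0%C = 1%C.

Definition orientation_preserving (f : C -> C) : Prop :=
  forall z, disk 1 z -> 0 < jacobian f z.

Definition univalent (f : C -> C) : Prop :=
  forall z w, disk 1 z -> disk 1 w -> f z = f w -> z = w.

Definition spiral_segment (lambda : R) (w0 w : C) : Prop :=
  (exists t : R, t <= 0 /\ w = (w0 * Cexp (t * Cexp (Ci * lambda)))%C) \/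
  w = 0%C.

Definition spirallike (lambda : R) (Omega : C -> Prop) : Prop :=
  domain Omega /\
  forall w, Omega w -> w <> 0%C ->
    forall v, spiral_segment lambda w v -> Omega v.

Definition SP_H (lambda : R) (f : C -> C) : Prop :=
  class_H0 f /\ orientation_preserving f /\ univalent f /\
  forall r, 0 < r < 1 -> spirallike lambda (image f (disk r)).

Definition V_boundary (alpha : R) (w : C) : Prop :=
  let tau := tan (PI * alpha / 2) in
  (exists theta : R, 0 <= theta <= PI /\
     w = Cexp ((- tau + Ci) * theta)) \/
  (exists theta : R, - PI <= theta <= 0 /\
     w = Cexp ((tau + Ci) * theta)).

Definition V (alpha : R) : C -> Prop := jordan_domain (V_boundary alpha).

Definition strongly_starlike (alpha : R) (Omega : C -> Prop) : Prop :=
  domain Omega /\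
  forall w0, Omega w0 -> forall w, V alpha w -> Omega (w0 * w)%C.

Definition SS_H (alpha : R) (f : C -> C) : Prop :=
  class_H0 f /\ orientation_preserving f /\ univalent f /\
  forall r, 0 < r < 1 -> strongly_starlike alpha (image f (disk r)).

Definition f_bn (b : C) (n : nat) (z : C) : C := (z + b * Cconj z ^ n)%C.

Definition C_n (n : nat) (alpha : R) : R :=
  2 * sin (PI * alpha / 2) /
  (INR n + 1 + Cmod (INR n + Cexp (Ci * (PI * alpha)))).

(* Main.v *)
Require Import Defs.
From Stdlib Require Import Reals.
From Coquelicot Require Import Coquelicot.
From Stdlib Require Import Lra Lia Psatz FunctionalExtensionality.
Open Scope R_scope.

(** Write [f z = z + b conj(z)^n], [s = sin (PI alpha / 2)] and [mu] for a
    direction [exp (i lambda)] or [exp (- i lambda)]; both have the real part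
    [s]. Moving the point [f z] inwards along the spiral [f z * exp (- t mu)]
    moves its preimage, and the derivative of [|z|^2 / 2] along this motion is a
    negative multiple of a real number [radial_form b n z (f z * mu)]. The images
    of all disks about [0] are invariant under the spiral exactly when this
    number is never negative. Explicitly ([radial_form_spiral]) it is

      [s (|z|^2 - n |b|^2 |z|^(2n)) + Re (b conj(z)^(n+1) (mu - n conj(mu)))],

    and since the argument of [z] is arbitrary, its minimum over a circle is
    [|z|^2 (s (1 - n x^2) - x A)] with [x = |b| |z|^(n-1)] and
    [A = |mu - n conj(mu)| = |n + exp (i PI alpha)|]. The quadratic polynomial in
    [x] has the positive root [C_n] ([C_n_root]). As [A] is the same for both
    directions, so is the condition [|b| <= C_n].

    The bound implies strong starlikeness ([SS_H_of_bound]): it forces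
    [n |b| < 1], so that [f] is a perturbation of the identity by a contraction,
    hence injective with open images of disks ([f_bn_solve]). The invariance
    under both spirals follows by composing many short steps, each of which
    raises [|z|^2] only to second order in its length ([spiral_step],
    [spiral_invariance]). The points of [V alpha] are those reached from [1] by
    the two spirals in succession, up to boundary points ([V_polar_form]).

    Strong starlikeness implies spirallikeness for any [f] ([SP_H_of_SS_H]),
    because the spiral contracted by a factor less than [1] lies in [V alpha],
    which is identified by a continuous function separating the two sides of its
    boundary ([V_of_spiral_height]).

    Spirallikeness implies the bound ([bound_of_SP_H]): the preimages of points
    of the spiral through [f z] cannot leave the closed disk of radius [|z|],
    and [f] has a local Lipschitz inverse, so the first order expansion
    [spiral_step_expansion] gives the sign of the radial form
    ([radial_form_of_spirals]). *)

(** * Open and path-connected sets of the plane *)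

Lemma open_Cmod (U : C -> Prop) :
  open U <->
  forall z, U z -> exists eps, 0 < eps /\ forall w, Cmod (w - z) < eps -> U w.
Proof.
  split.
  - intros HU z Hz. destruct (HU z Hz) as [e He].
    exists e. split; [apply cond_pos|]. intros w Hw. apply He.
    now apply C_NormedModule_mixin_compat1.
  - intros HU z Hz. destruct (HU z Hz) as [e [He H]].
    assert (Hs : 0 < sqrt 2) by (apply sqrt_lt_R0; lra).
    assert (He' : 0 < e / sqrt 2) by now apply Rdiv_lt_0_compat.
    exists (mkposreal _ He'). intros w Hw. apply H.
    apply (C_NormedModule_mixin_compat2 z w) in Hw. simpl in Hw.
    replace e with (sqrt 2 * (e / sqrt 2)) by (field; lra). exact Hw.
Qed.

Lemma continuous_of_Re_Im (g : R -> C) (t : R) :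
  continuous (fun s => Re (g s)) t -> continuous (fun s => Im (g s)) t ->
  continuous g t.
Proof.
  intros H1 H2 P [e He].
  destruct (H1 (ball (Re (g t)) e) (locally_ball _ e)) as [d1 Hd1].
  destruct (H2 (ball (Im (g t)) e) (locally_ball _ e)) as [d2 Hd2].
  assert (Hd : 0 < Rmin d1 d2) by (apply Rmin_pos; apply cond_pos).
  exists (mkposreal _ Hd). intros s Hs. apply He. split.
  - apply Hd1. eapply Rlt_le_trans; [exact Hs|]. apply Rmin_l.
  - apply Hd2. eapply Rlt_le_trans; [exact Hs|]. apply Rmin_r.
Qed.

(** Connectedness of the parameter interval, by the supremum of the
    parameters that the path sends into [U]. *)
Lemma path_meets (g : R -> C) (U V : C -> Prop) :
  (forall t, 0 <= t <= 1 -> continuous g t) ->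
  open U -> open V -> (forall t, 0 <= t <= 1 -> U (g t) \/ V (g t)) ->
  U (g 0) -> V (g 1) ->
  exists t, 0 <= t <= 1 /\ U (g t) /\ V (g t).
Proof.
  intros Hg HU HV HUV H0 H1.
  set (E := fun t => 0 <= t <= 1 /\ U (g t)).
  destruct (completeness E) as [m [Hub Hleast]].
  { exists 1. intros t [Ht _]. lra. }
  { exists 0. split; [lra|assumption]. }
  assert (Hm0 : 0 <= m) by (apply Hub; split; [lra|assumption]).
  assert (Hm1 : m <= 1) by (apply Hleast; intros t [Ht _]; lra).
  assert (Hloc : forall W : C -> Prop, open W -> W (g m) ->
            exists d : posreal, forall t, Rabs (t - m) < d -> W (g t)).
  { intros W HW HWm. destruct (Hg m (conj Hm0 Hm1) W (HW _ HWm)) as [d Hd].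
    exists d. intros t Ht. now apply Hd. }
  destruct (HUV m (conj Hm0 Hm1)) as [HmU|HmV].
  - destruct (Hloc U HU HmU) as [d Hd].
    destruct (Req_dec m 1) as [->|Hne].
    { exists 1. repeat split; try lra; assumption. }
    exfalso. set (t := Rmin 1 (m + d / 2)).
    assert (Hd0 := cond_pos d).
    assert (Ht : m < t <= 1 /\ t <= m + d / 2).
    { unfold t, Rmin. destruct (Rle_dec 1 (m + d / 2)); lra. }
    assert (t <= m); [|lra]. apply Hub. split; [lra|].
    apply Hd. rewrite Rabs_right; lra.
  - destruct (Hloc V HV HmV) as [d Hd].
    assert (Hd0 := cond_pos d).
    destruct (Classical_Prop.classic (exists t, E t /\ m - d < t))
      as [[t [[Ht HtU] Htm]]|Hno].
    + exists t. repeat split; try lra; trivial. apply Hd.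
      assert (t <= m) by (apply Hub; now split).
      rewrite Rabs_left1; lra.
    + exfalso. assert (m <= m - d); [|lra]. apply Hleast. intros t Ht.
      destruct (Rle_dec t (m - d)); trivial. exfalso. apply Hno.
      exists t. split; [assumption|lra].
Qed.

Lemma connected_of_paths (A : C -> Prop) (a : C) :
  (forall z, A z -> exists g : R -> C,
     (forall t, 0 <= t <= 1 -> continuous g t /\ A (g t)) /\
     g 0 = a /\ g 1 = z) ->
  connected A.
Proof.
  assert (key : forall U V : C -> Prop, open U -> open V ->
    (forall z, A z -> U z \/ V z) -> U a ->
    forall z, A z -> V z ->
    (exists g : R -> C,
     (forall t, 0 <= t <= 1 -> continuous g t /\ A (g t)) /\
     g 0 = a /\ g 1 = z) -> exists z, A z /\ U z /\ V z).
  { intros U V HU HV HUV HaU z Hz HzV [g [Hg [Hg0 Hg1]]].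
    destruct (path_meets g U V) as [t [Ht [H1 H2]]]; trivial.
    - intros t Ht. now apply Hg.
    - intros t Ht. apply HUV. now apply Hg.
    - now rewrite Hg0.
    - now rewrite Hg1.
    - exists (g t). split; [now apply Hg|now split]. }
  intros HA U V HU HV HUV [u [Hu HuU]] [v [Hv HvV]].
  assert (Ha : A a).
  { destruct (HA u Hu) as [g [Hg [<- _]]]. apply Hg. lra. }
  destruct (HUV a Ha) as [HaU|HaV].
  - apply (key U V) with v; auto.
  - destruct (key V U) with u as [z Hz]; auto.
    + intros z Hz. destruct (HUV z Hz); auto.
    + exists z. tauto.
Qed.

(** * The exponential map and polar coordinates *)

Lemma Cexp_add (z w : C) : Cexp (z + w) = (Cexp z * Cexp w)%C.
Proof.
  unfold Cexp, Cmult, Cplus, Re, Im; simpl.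
  rewrite exp_plus, cos_plus, sin_plus. f_equal; ring.
Qed.

Lemma Cmod_Cexp (z : C) : Cmod (Cexp z) = exp (Re z).
Proof.
  unfold Cmod, Cexp; simpl.
  replace (_ + _) with (Rsqr (exp (Re z)) * (Rsqr (sin (Im z)) + Rsqr (cos (Im z))))
    by (unfold Rsqr; ring).
  rewrite sin2_cos2, Rmult_1_r. apply sqrt_Rsqr, Rlt_le, exp_pos.
Qed.

Lemma Cexp_neq_0 (z : C) : Cexp z <> 0%C.
Proof.
  intros H. assert (H1 := Cmod_Cexp z). rewrite H, Cmod_0 in H1.
  assert (H2 := exp_pos (Re z)). lra.
Qed.

Lemma Cexp_0 : Cexp 0 = 1%C.
Proof.
  unfold Cexp; simpl. rewrite exp_0, cos_0, sin_0. unfold RtoC. f_equal; ring.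
Qed.

Lemma Cmod_le_abs (z : C) : Cmod z <= Rabs (Re z) + Rabs (Im z).
Proof.
  replace z with (RtoC (Re z) + Ci * RtoC (Im z))%C at 1
    by (destruct z; unfold Cplus, Cmult, RtoC, Ci, Re, Im; simpl; f_equal; ring).
  eapply Rle_trans; [apply Cmod_triangle|].
  rewrite Cmod_mult, Cmod_Ci, !Cmod_R. lra.
Qed.

Lemma im_le_Cmod (z : C) : Rabs (Im z) <= Cmod z.
Proof. eapply Rle_trans; [|apply Rmax_Cmod]. apply Rmax_r. Qed.

Lemma polar_form (w : C) : w <> 0%C ->
  exists theta, Rabs theta = acos (Re w / Cmod w) /\
    w = Cexp (ln (Cmod w), theta).
Proof.
  intros Hw. assert (Hm : 0 < Cmod w) by now apply Cmod_gt_0.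
  assert (Hsq := Cmod2_alt w).
  set (u := Re w / Cmod w).
  assert (Hu : Re w = Cmod w * u) by (unfold u; field; lra).
  assert (Hu1 : -1 <= u <= 1).
  { apply Rabs_le_between. unfold u. rewrite Rabs_div by lra.
    rewrite (Rabs_right (Cmod w)) by lra.
    apply Rle_div_l; [lra|]. rewrite Rmult_1_l. apply re_le_Cmod. }
  assert (Hi : Rabs (Im w) = Cmod w * sqrt (1 - Rsqr u)).
  { rewrite <- (sqrt_Rsqr_abs (Im w)). rewrite <- (sqrt_Rsqr (Cmod w)) at 1 by lra.
    rewrite <- sqrt_mult_alt by apply Rle_0_sqr. f_equal.
    unfold Rsqr. rewrite Hu in Hsq. nra. }
  assert (Hb := acos_bound u).
  destruct (Rle_dec 0 (Im w)) as [Hs|Hs].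
  - exists (acos u). split; [apply Rabs_right; lra|].
    unfold Cexp; simpl. rewrite exp_ln, cos_acos, sin_acos by trivial.
    rewrite <- Hu, <- Hi, Rabs_right by lra. now destruct w.
  - exists (- acos u). split; [rewrite Rabs_Ropp; apply Rabs_right; lra|].
    unfold Cexp; simpl. rewrite cos_neg, sin_neg, exp_ln, cos_acos, sin_acos by trivial.
    replace (Cmod w * - sqrt (1 - u²)) with (- (Cmod w * sqrt (1 - u²))) by ring.
    rewrite <- Hu, <- Hi, Rabs_left by lra.
    destruct w; simpl; f_equal; ring.
Qed.

Lemma Re_Cexp_div_Cmod (z : C) : Re (Cexp z) / Cmod (Cexp z) = cos (Im z).
Proof.
  rewrite Cmod_Cexp. unfold Cexp; simpl. field. apply Rgt_not_eq, exp_pos.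
Qed.

Lemma acos_cos_abs (t : R) : acos (cos t) <= Rabs t.
Proof.
  assert (Hb := acos_bound (cos t)).
  destruct (Rle_dec (Rabs t) PI) as [H|H]; [|lra].
  replace (cos t) with (cos (Rabs t)).
  - rewrite acos_cos; [lra|]. split; [apply Rabs_pos|assumption].
  - unfold Rabs. destruct (Rcase_abs t); [apply cos_neg|trivial].
Qed.

Lemma acos_lt_of_cos (u c : R) : 0 <= c <= PI -> -1 <= u <= 1 ->
  cos c < u -> acos u < c.
Proof.
  intros Hc Hu H. destruct (Rlt_dec (acos u) c) as [|Hn]; trivial. exfalso.
  assert (Hb := acos_bound u).
  assert (cos (acos u) <= cos c) by (apply cos_decr_1; lra).
  rewrite cos_acos in H0; lra.
Qed.

Lemma acos_gt_of_cos (u c : R) : 0 <= c <= PI -> -1 <= u <= 1 ->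
  u < cos c -> c < acos u.
Proof.
  intros Hc Hu H. destruct (Rlt_dec c (acos u)) as [|Hn]; trivial. exfalso.
  assert (Hb := acos_bound u).
  assert (cos c <= cos (acos u)) by (apply cos_decr_1; lra).
  rewrite cos_acos in H0; lra.
Qed.

(** Monotonicity of the cosine gives continuity also at the end points [-1] and
    [1], where [acos] has no derivative; the negative real axis, at which the
    two spirals meet, corresponds to [-1]. *)
Lemma acos_continuity (u : R) (eps : R) : -1 <= u <= 1 -> 0 < eps ->
  exists d, 0 < d /\ forall v, -1 <= v <= 1 -> Rabs (v - u) < d ->
    Rabs (acos v - acos u) < eps.
Proof.
  intros Hu He. assert (Hb := acos_bound u). assert (Hc := cos_acos u Hu).
  assert (Hup : exists d, 0 < d /\ forall v, -1 <= v <= 1 -> Rabs (v - u) < d ->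
    acos v < acos u + eps).
  { destruct (Rle_dec (acos u + eps) PI) as [Hle|Hn].
    - assert (cos (acos u + eps) < cos (acos u)) by (apply cos_decreasing_1; lra).
      exists (u - cos (acos u + eps)). split; [lra|]. intros v Hv Hd.
      apply Rabs_lt_between in Hd. apply acos_lt_of_cos; lra.
    - exists 1. split; [lra|]. intros v _ _. assert (Hv := acos_bound v). lra. }
  assert (Hlo : exists d, 0 < d /\ forall v, -1 <= v <= 1 -> Rabs (v - u) < d ->
    acos u - eps < acos v).
  { destruct (Rle_dec 0 (acos u - eps)) as [Hle|Hn].
    - assert (cos (acos u) < cos (acos u - eps)) by (apply cos_decreasing_1; lra).
      exists (cos (acos u - eps) - u). split; [lra|]. intros v Hv Hd.
      apply Rabs_lt_between in Hd. apply acos_gt_of_cos; lra.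
    - exists 1. split; [lra|]. intros v _ _. assert (Hv := acos_bound v). lra. }
  destruct Hup as [d1 [Hd1 H1]], Hlo as [d2 [Hd2 H2]].
  exists (Rmin d1 d2). split; [now apply Rmin_pos|]. intros v Hv Hd.
  apply Rabs_lt_between.
  assert (Rabs (v - u) < d1) by (eapply Rlt_le_trans; [exact Hd|apply Rmin_l]).
  assert (Rabs (v - u) < d2) by (eapply Rlt_le_trans; [exact Hd|apply Rmin_r]).
  specialize (H1 v Hv H). specialize (H2 v Hv H0). lra.
Qed.

(** * The region between the two logarithmic spirals *)

Lemma Cmod_continuous (w : C) : continuous Cmod w.
Proof.
  intros P [e He]. apply locally_C. exists e. intros v0 Hv. set (v := v0 : C). apply He.
  change (Rabs (Cmod v - Cmod w) < e).
  change (Cmod (v - w) < e) in Hv.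
  assert (H1 := Cmod_triangle (v - w) w). assert (H2 := Cmod_triangle (w - v) v).
  replace (v - w + w)%C with v in H1 by ring.
  replace (w - v + v)%C with w in H2 by ring.
  replace (w - v)%C with (- (v - w))%C in H2 by ring. rewrite Cmod_opp in H2.
  apply Rabs_lt_between. lra.
Qed.

Lemma Re_div_Cmod_bound (w : C) : -1 <= Re w / Cmod w <= 1.
Proof.
  destruct (Ceq_dec w 0%C) as [->|Hw].
  - unfold Re, Rdiv; simpl. lra.
  - destruct (polar_form w Hw) as [t [_ ->]]. rewrite Re_Cexp_div_Cmod.
    apply COS_bound.
Qed.

(** With [tau = tan (PI alpha / 2)], [exp (spiral_height tau w)] is the gauge of
    the region between the two spirals: it is [1] on the spirals, and
    multiplying [w] by a positive factor multiplies it by the same factor. *)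
Definition spiral_height (tau : R) (w : C) : R :=
  ln (Cmod w) + tau * acos (Re w / Cmod w).

Lemma spiral_height_Cexp (tau x t : R) :
  spiral_height tau (Cexp (x, t)) = x + tau * acos (cos t).
Proof.
  unfold spiral_height. rewrite Re_Cexp_div_Cmod, Cmod_Cexp, ln_exp. reflexivity.
Qed.

Lemma spiral_height_continuous (tau : R) (w : C) :
  w <> 0%C -> continuous (spiral_height tau) w.
Proof.
  intros Hw. assert (Hm : 0 < Cmod w) by now apply Cmod_gt_0.
  unfold spiral_height.
  apply (continuous_plus (K := R_AbsRing) (V := R_NormedModule)).
  - apply (continuous_comp Cmod ln); [apply Cmod_continuous|].
    apply continuity_pt_filterlim, derivable_continuous_pt.
    exists (/ Cmod w). now apply derivable_pt_lim_ln.
  - apply (continuous_mult (K := R_AbsRing)); [apply continuous_const|].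
    assert (Hq : continuous (fun v : C => Re v / Cmod v) w).
    { apply (continuous_mult (K := R_AbsRing)); [apply continuous_fst|].
      apply (continuous_comp Cmod Rinv); [apply Cmod_continuous|].
      apply continuity_pt_filterlim, continuity_pt_inv;
        [apply continuity_pt_id|]. unfold id. lra. }
    intros P [e He].
    destruct (acos_continuity (Re w / Cmod w) e (Re_div_Cmod_bound w) (cond_pos e))
      as [d [Hd H]].
    change (locally w (fun v : C => P (acos (Re v / Cmod v)))).
    apply (filter_imp (fun v : C => Rabs (Re v / Cmod v - Re w / Cmod w) < d)).
    + intros v Hv. apply He. change (Rabs (acos (Re v / Cmod v) - acos (Re w / Cmod w)) < e).
      apply H; [apply Re_div_Cmod_bound|assumption].
    + apply (Hq (fun y => Rabs (y - Re w / Cmod w) < d)).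
      exists (mkposreal d Hd). intros y Hy. exact Hy.
Qed.

Lemma spiral_height_principal (tau : R) (w : C) : w <> 0%C ->
  exists x t, Rabs t <= PI /\ w = Cexp (x, t) /\
    spiral_height tau w = x + tau * Rabs t.
Proof.
  intros Hw. destruct (polar_form w Hw) as [t [Ht Hwt]].
  exists (ln (Cmod w)), t. repeat split; trivial.
  - rewrite Ht. apply acos_bound.
  - unfold spiral_height. now rewrite Ht.
Qed.

Lemma tan_pos (alpha : R) : 0 < alpha < 1 -> 0 < tan (PI * alpha / 2).
Proof. intros H. assert (Hp := PI_RGT_0). apply tan_gt_0; nra. Qed.

Lemma V_boundary_upper_arg (tau theta : R) :
  ((- RtoC tau + Ci) * RtoC theta)%C = (- tau * theta, theta).
Proof. unfold Ci, RtoC, Cmult, Cplus, Copp; simpl. f_equal; ring. Qed.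

Lemma V_boundary_lower_arg (tau theta : R) :
  ((RtoC tau + Ci) * RtoC theta)%C = (tau * theta, theta).
Proof. unfold Ci, RtoC, Cmult, Cplus; simpl. f_equal; ring. Qed.

(** On both spirals the radius is [exp (- tau |theta|)], with
    [|theta| <= PI]. *)
Lemma V_boundary_spiral_height (alpha : R) (w : C) :
  V_boundary alpha w <->
  w <> 0%C /\ spiral_height (tan (PI * alpha / 2)) w = 0.
Proof.
  assert (Hpi := PI_RGT_0).
  unfold V_boundary. set (tau := tan (PI * alpha / 2)). split.
  - intros [[t [Ht ->]]|[t [Ht ->]]]; (split; [apply Cexp_neq_0|]).
    + rewrite V_boundary_upper_arg, spiral_height_Cexp, acos_cos by lra. ring.
    + rewrite V_boundary_lower_arg, spiral_height_Cexp, <- cos_neg, acos_cos by lra.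
      ring.
  - intros [Hw H].
    destruct (spiral_height_principal tau w Hw) as [x [t [Ht [-> Hh]]]].
    rewrite Hh in H. unfold Rabs in Ht, H. destruct (Rcase_abs t).
    + right. exists t. split; [lra|]. rewrite V_boundary_lower_arg.
      do 2 f_equal. lra.
    + left. exists t. split; [lra|]. rewrite V_boundary_upper_arg.
      do 2 f_equal. lra.
Qed.

Lemma spiral_height_sub_open (tau : R) : 0 < tau ->
  open (fun w : C => w = 0%C \/ w <> 0%C /\ spiral_height tau w < 0).
Proof.
  intros Ht w [->|[Hw H]].
  - assert (Hd := exp_pos (- tau * PI)).
    apply locally_C. exists (mkposreal _ Hd). intros v0 Hv. set (v := v0 : C).
    change (Cmod (v - 0) < exp (- tau * PI)) in Hv.
    replace (v - 0)%C with v in Hv by ring.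
    destruct (Ceq_dec v 0%C) as [|Hn]; [now left|right]. split; trivial.
    unfold spiral_height. assert (Hb := acos_bound (Re v / Cmod v)).
    assert (Hm : 0 < Cmod v) by now apply Cmod_gt_0.
    assert (ln (Cmod v) < - tau * PI).
    { rewrite <- (ln_exp (- tau * PI)). now apply ln_increasing. }
    nra.
  - apply (filter_imp (fun v : C => 0 < Cmod v /\ spiral_height tau v < 0)).
    + intros v [Hv Hv']. right. split; [now apply Cmod_gt_0|assumption].
    + apply filter_and.
      * apply (Cmod_continuous w (fun y => 0 < y)), open_gt. now apply Cmod_gt_0.
      * apply (spiral_height_continuous tau w Hw (fun y => y < 0)), open_lt.
        assumption.
Qed.

Lemma spiral_height_super_open (tau : R) :
  open (fun w : C => w <> 0%C /\ 0 < spiral_height tau w).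
Proof.
  intros w [Hw H].
  apply (filter_imp (fun v : C => 0 < Cmod v /\ 0 < spiral_height tau v)).
  - intros v [Hv Hv']. split; [now apply Cmod_gt_0|assumption].
  - apply filter_and.
    + apply (Cmod_continuous w (fun y => 0 < y)), open_gt. now apply Cmod_gt_0.
    + apply (spiral_height_continuous tau w Hw (fun y => 0 < y)), open_gt.
      assumption.
Qed.

(** Where the height is negative the boundary is not met, and a connected set
    avoiding the boundary cannot reach the open region of positive height. *)
Lemma V_of_spiral_height (alpha : R) (w : C) : 0 < alpha < 1 ->
  w = 0%C \/ w <> 0%C /\ spiral_height (tan (PI * alpha / 2)) w < 0 ->
  V alpha w.
Proof.
  intros Ha Hw. assert (Ht := tan_pos alpha Ha). split.
  - intros H. apply V_boundary_spiral_height in H. destruct H as [H1 H2].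
    destruct Hw as [|[_ H]]; [contradiction|lra].
  - exists 1. intros z [B [HB [HBG [HBw HBz]]]].
    set (tau := tan (PI * alpha / 2)) in *.
    assert (Hz : z = 0%C \/ z <> 0%C /\ spiral_height tau z < 0).
    { destruct (Ceq_dec z 0%C) as [|Hz0]; [now left|right]. split; trivial.
      apply Rnot_le_lt. intros Hle.
      destruct (HB _ _ (spiral_height_sub_open tau Ht) (spiral_height_super_open tau))
        as [v [_ [Hv1 [Hv0 Hv2]]]].
      - intros v Hv. destruct (Ceq_dec v 0%C) as [|Hv0]; [now left; left|].
        destruct (Rtotal_order (spiral_height tau v) 0) as [Hl|[He|Hg]].
        + left; right; now split.
        + exfalso. apply (HBG v Hv). apply V_boundary_spiral_height. now split.
        + right. split; [assumption|lra].
      - exists w. now split.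
      - exists z. split; [assumption|]. split; [assumption|].
        destruct Hle as [Hlt|He]; [assumption|]. exfalso.
        apply (HBG z HBz). apply V_boundary_spiral_height. now split.
      - destruct Hv1 as [|[_ Hv1]]; [contradiction|lra]. }
    destruct Hz as [->|[Hz0 Hz]]; [rewrite Cmod_0; lra|].
    assert (Hm : 0 < Cmod z) by now apply Cmod_gt_0.
    unfold spiral_height in Hz. assert (Hb := acos_bound (Re z / Cmod z)).
    assert (Hl : ln (Cmod z) < 0) by nra.
    rewrite <- ln_1 in Hl. apply ln_lt_inv in Hl; lra.
Qed.

Lemma Cexp_ray_continuous (x th u t : R) :
  continuous (fun s => Cexp (x + s * u, th)) t.
Proof.
  unfold Cexp; simpl.
  assert (H : forall c : R, continuous (fun s => exp (x + s * u) * c) t).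
  { intros c. apply (continuous_mult (K := R_AbsRing)); [|apply continuous_const].
    apply continuous_exp_comp.
    apply (continuous_plus (K := R_AbsRing) (V := R_NormedModule));
      [apply continuous_const|].
    apply (continuous_mult (K := R_AbsRing)); [apply continuous_id|apply continuous_const]. }
  apply continuous_of_Re_Im; apply H.
Qed.

(** From a point of positive height the outward radial ray escapes to infinity
    without meeting the boundary, so the component of such a point is
    unbounded. *)
Lemma V_polar_form (alpha : R) (w : C) : 0 < alpha < 1 ->
  V alpha w -> w = 0%C \/
  exists x t, w = Cexp (x, t) /\ x + tan (PI * alpha / 2) * Rabs t <= 0.
Proof.
  intros Ha [HG [M HM]]. set (tau := tan (PI * alpha / 2)) in *.
  destruct (Ceq_dec w 0%C) as [|Hw]; [now left|right].
  destruct (spiral_height_principal tau w Hw) as [x [t [Ht [Hwt Hh]]]].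
  exists x, t. split; [assumption|]. rewrite <- Hh. apply Rnot_lt_le. intros Hpos.
  (* [exp (x + u) >= exp x (1 + u) >= M + 1] *)
  set (u := Rmax 0 (M + 1 - exp x) / exp x).
  assert (He := exp_pos x).
  assert (Hu : 0 <= u).
  { apply Rdiv_le_0_compat; [apply Rmax_l|assumption]. }
  assert (Hbig : M + 1 <= exp (x + u)).
  { rewrite exp_plus. assert (H1 := exp_ineq1_le u).
    assert (exp x * (1 + u) = exp x + Rmax 0 (M + 1 - exp x))
      by (unfold u; field; lra).
    assert (H2 := Rmax_r 0 (M + 1 - exp x)). nra. }
  assert (Hc : Cmod (Cexp (x + u, t)) <= M).
  { apply HM. exists (fun z => exists v, 0 <= v /\ z = Cexp (x + v, t)).
    split; [|split; [|split]].
    - apply (connected_of_paths _ (Cexp (x + 0, t))). intros z [v [Hv ->]].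
      exists (fun s => Cexp (x + s * v, t)). split.
      + intros s Hs. split; [apply Cexp_ray_continuous|].
        exists (s * v). split; [nra|reflexivity].
      + split; do 3 f_equal; ring.
    - intros z [v [Hv ->]] HV. apply V_boundary_spiral_height in HV.
      destruct HV as [_ HV]. fold tau in HV.
      rewrite spiral_height_Cexp in HV.
      rewrite Hwt, spiral_height_Cexp in Hpos. lra.
    - exists 0. split; [lra|]. now rewrite Rplus_0_r.
    - exists u. now split. }
  rewrite Cmod_Cexp in Hc. simpl in Hc. lra.
Qed.

(** * Taylor and Lipschitz estimates *)

Lemma pow_le_1 (x : R) (m : nat) : 0 <= x <= 1 -> 0 <= x ^ m <= 1.
Proof.
  intros Hx. split; [now apply pow_le|].
  rewrite <- (pow1 m). now apply pow_incr.
Qed.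

Lemma Cmod_pow_le_1 (z : C) (n : nat) : Cmod z <= 1 -> Cmod (z ^ n) <= 1.
Proof.
  intros Hz. rewrite Cmod_pow. apply pow_le_1.
  split; [apply Cmod_ge_0|assumption].
Qed.

Lemma Cpow_lipschitz (n : nat) (r : R) (z w : C) :
  Cmod z <= r -> Cmod w <= r ->
  Cmod (z ^ n - w ^ n) <= INR n * r ^ pred n * Cmod (z - w).
Proof.
  intros Hz Hw. assert (H0z := Cmod_ge_0 z).
  induction n as [|n IH].
  - simpl. replace (1 - 1)%C with (RtoC 0) by ring. rewrite Cmod_0. lra.
  - replace (z ^ S n - w ^ S n)%C with (z * (z ^ n - w ^ n) + (z - w) * w ^ n)%C
      by (simpl; ring).
    eapply Rle_trans; [apply Cmod_triangle|]. rewrite !Cmod_mult, Cmod_pow.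
    assert (Hd := Cmod_ge_0 (z - w)). assert (Hp := Cmod_ge_0 (z ^ n - w ^ n)).
    assert (Hwn : Cmod w ^ n <= r ^ n)
      by (apply pow_incr; split; [apply Cmod_ge_0|assumption]).
    assert (Hrn : INR n * r ^ pred n * r = INR n * r ^ n)
      by (destruct n; simpl; ring).
    rewrite S_INR. change (pred (S n)) with n.
    assert (Cmod z * Cmod (z ^ n - w ^ n) <= r * (INR n * r ^ pred n * Cmod (z - w)))
      by (apply Rmult_le_compat; trivial).
    assert (Cmod (z - w) * Cmod w ^ n <= Cmod (z - w) * r ^ n)
      by (apply Rmult_le_compat_l; trivial).
    replace ((INR n + 1) * r ^ n * Cmod (z - w))
      with (INR n * r ^ n * Cmod (z - w) + r ^ n * Cmod (z - w)) by ring.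
    rewrite <- Hrn. lra.
Qed.

Lemma Cpow_taylor (n : nat) (z h : C) :
  Cmod z <= 1 -> Cmod (z + h) <= 1 ->
  Cmod ((z + h) ^ n - z ^ n - INR n * z ^ pred n * h) <= INR n ^ 2 * Cmod h ^ 2.
Proof.
  intros Hz Hh. induction n as [|n IH].
  - simpl. replace (_ - _)%C with (RtoC 0) by ring. rewrite Cmod_0. lra.
  - replace ((z + h) ^ S n - z ^ S n - INR (S n) * z ^ pred (S n) * h)%C
      with ((z + h) * ((z + h) ^ n - z ^ n - INR n * z ^ pred n * h)
            + INR n * z ^ pred n * (h * h))%C.
    2:{ rewrite S_INR, RtoC_plus. change (pred (S n)) with n.
        destruct n as [|n]; simpl; ring. }
    eapply Rle_trans; [apply Cmod_triangle|]. rewrite !Cmod_mult, Cmod_R.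
    assert (Hn := pos_INR n). rewrite (Rabs_right (INR n)) by lra.
    set (E := Cmod (_ - _)) in *.
    assert (HE : 0 <= E) by apply Cmod_ge_0.
    assert (Hp := Cmod_pow_le_1 z (pred n) Hz).
    assert (Hp0 := Cmod_ge_0 (z ^ pred n)). assert (Hh0 := Cmod_ge_0 h).
    assert (Hzh := Cmod_ge_0 (z + h)).
    assert (Cmod (z + h) * E <= E) by nra.
    assert (Hhh : 0 <= Cmod h * Cmod h) by nra.
    assert (INR n * Cmod (z ^ pred n) <= INR n) by nra.
    assert (INR n * Cmod (z ^ pred n) * (Cmod h * Cmod h)
            <= INR n * (Cmod h * Cmod h)) by (apply Rmult_le_compat_r; assumption).
    rewrite S_INR. simpl in IH |- *. nra.
Qed.

Lemma exp_taylor (x : R) : Rabs x <= 1 / 2 ->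
  Rabs (exp x - 1 - x) <= 2 * x ^ 2 /\ exp x <= 2.
Proof.
  intros Hx. apply Rabs_le_between in Hx.
  assert (H1 := exp_ineq1_le x). assert (H2 := exp_ineq1_le (- x)).
  assert (H3 : exp x * exp (- x) = 1).
  { rewrite <- exp_plus, Rplus_opp_r. apply exp_0. }
  assert (He := exp_pos x).
  assert (H4 : exp x * (1 - x) <= 1) by nra.
  split; [|nra].
  rewrite Rabs_right by lra. nra.
Qed.

Lemma sin_abs_le (y : R) : Rabs (sin y) <= Rabs y.
Proof.
  destruct (MVT_gen sin 0 y cos) as [c [_ Hc]].
  - intros x _. apply is_derive_Reals, derivable_pt_lim_sin.
  - intros x _. apply continuity_sin.
  - rewrite sin_0, !Rminus_0_r in Hc. rewrite Hc, Rabs_mult.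
    assert (Rabs (cos c) <= 1) by (apply Rabs_le, COS_bound).
    assert (H0 := Rabs_pos y). nra.
Qed.

Lemma between_0_abs (c y : R) : Rmin 0 y <= c <= Rmax 0 y -> Rabs c <= Rabs y.
Proof.
  unfold Rmin, Rmax, Rabs. destruct (Rle_dec 0 y), (Rcase_abs c), (Rcase_abs y); lra.
Qed.

Lemma cos_taylor (y : R) : Rabs (cos y - 1) <= y ^ 2.
Proof.
  destruct (MVT_gen cos 0 y (fun t => - sin t)) as [c [Hc H]].
  - intros x _. apply is_derive_Reals, derivable_pt_lim_cos.
  - intros x _. apply continuity_cos.
  - rewrite cos_0, Rminus_0_r in H. rewrite H, Rabs_mult, Rabs_Ropp.
    apply between_0_abs in Hc. assert (Hs := sin_abs_le c).
    assert (H0 := Rabs_pos y). rewrite <- (pow2_abs y). nra.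
Qed.

Lemma sin_taylor (y : R) : Rabs y <= 1 -> Rabs (sin y - y) <= y ^ 2.
Proof.
  intros Hy.
  destruct (MVT_gen (fun t => sin t - t) 0 y (fun t => cos t - 1)) as [c [Hc H]].
  - intros x _. auto_derive; trivial. ring.
  - intros x _. apply continuity_minus; [apply continuity_sin|apply derivable_continuous, derivable_id].
  - rewrite sin_0, !Rminus_0_r in H. rewrite H, Rabs_mult.
    apply between_0_abs in Hc. assert (Hs := cos_taylor c).
    assert (H0 := Rabs_pos y). assert (H1 := Rabs_pos c).
    rewrite <- (pow2_abs y). rewrite <- (pow2_abs c) in Hs. nra.
Qed.

Lemma Cexp_taylor (z : C) : Cmod z <= 1 / 2 ->
  Cmod (Cexp z - 1 - z) <= 5 * Cmod z ^ 2.
Proof.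
  intros Hz.
  assert (Hx := Rle_trans _ _ _ (re_le_Cmod z) Hz).
  assert (Hy := Rle_trans _ _ _ (im_le_Cmod z) Hz).
  rewrite Cmod2_alt. eapply Rle_trans; [apply Cmod_le_abs|].
  destruct z as [x y]; unfold Cexp, Cminus, Cplus, Copp, RtoC, Re, Im in *; simpl in *.
  destruct (exp_taylor x Hx) as [H1 H2]. assert (H3 := cos_taylor y).
  assert (H4 := sin_taylor y ltac:(lra)). assert (He := exp_pos x).
  replace (exp x * cos y + - (1) + - x)
    with ((exp x - 1 - x) + exp x * (cos y - 1)) by ring.
  replace (exp x * sin y + - 0 + - y)
    with (exp x * (sin y - y) + (exp x - 1 - x) * y + x * y) by ring.
  assert (T1 := Rabs_triang (exp x - 1 - x) (exp x * (cos y - 1))).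
  assert (T2 := Rabs_triang (exp x * (sin y - y) + (exp x - 1 - x) * y) (x * y)).
  assert (T3 := Rabs_triang (exp x * (sin y - y)) ((exp x - 1 - x) * y)).
  rewrite !Rabs_mult, (Rabs_right (exp x)) in * by lra.
  assert (B1 : exp x * Rabs (cos y - 1) <= 2 * y ^ 2)
    by (apply Rmult_le_compat; try lra; apply Rabs_pos).
  assert (B2 : exp x * Rabs (sin y - y) <= 2 * y ^ 2)
    by (apply Rmult_le_compat; try lra; apply Rabs_pos).
  assert (B3 : Rabs (exp x - 1 - x) * Rabs y <= 2 * x ^ 2 * (1 / 2))
    by (apply Rmult_le_compat; try lra; apply Rabs_pos).
  assert (B4 : Rabs x * Rabs y <= (x ^ 2 + y ^ 2) / 2).
  { rewrite <- (pow2_abs x), <- (pow2_abs y).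
    assert (H0 := pow2_ge_0 (Rabs x - Rabs y)). nra. }
  simpl in *. nra.
Qed.

(** * The map [z + b conj(z)^n] as a perturbation of the identity *)

Lemma f_bn_minus (b : C) (n : nat) (z w : C) :
  (f_bn b n z - f_bn b n w = (z - w) + b * (Cconj z ^ n - Cconj w ^ n))%C.
Proof. unfold f_bn. ring. Qed.

Lemma conj_power_lipschitz (b : C) (n : nat) (r : R) (z w : C) :
  Cmod z <= r -> Cmod w <= r ->
  Cmod (b * (Cconj z ^ n - Cconj w ^ n))
    <= INR n * Cmod b * r ^ pred n * Cmod (z - w).
Proof.
  intros Hz Hw. rewrite Cmod_mult.
  rewrite <- (Cmod_conj (z - w)), Cminus_conj.
  assert (H := Cpow_lipschitz n r (Cconj z) (Cconj w)). rewrite !Cmod_conj in H.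
  specialize (H Hz Hw). assert (Hb := Cmod_ge_0 b).
  replace (INR n * Cmod b * r ^ pred n * Cmod (Cconj z - Cconj w))
    with (Cmod b * (INR n * r ^ pred n * Cmod (Cconj z - Cconj w))) by ring.
  now apply Rmult_le_compat_l.
Qed.

Lemma f_bn_lower_lipschitz (b : C) (n : nat) (r : R) (z w : C) :
  Cmod z <= r -> Cmod w <= r ->
  (1 - INR n * Cmod b * r ^ pred n) * Cmod (z - w)
    <= Cmod (f_bn b n z - f_bn b n w).
Proof.
  intros Hz Hw. assert (H := conj_power_lipschitz b n r z w Hz Hw).
  rewrite f_bn_minus. set (e := (b * _)%C) in *.
  assert (T := Cmod_triangle ((z - w) + e) (- e)).
  replace ((z - w) + e + - e)%C with (z - w)%C in T by ring.
  rewrite Cmod_opp in T. lra.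
Qed.

(** The sequences [a k - d q^k / (1-q)] and [a k + d q^k / (1-q)] are monotone
    and enclose the limit. *)
Lemma geometric_limit (a : nat -> R) (d q : R) : 0 <= q < 1 ->
  (forall k, Rabs (a (S k) - a k) <= d * q ^ k) ->
  exists l, forall k, Rabs (a k - l) <= d / (1 - q) * q ^ k.
Proof.
  intros Hq Ha. set (e := fun k => d / (1 - q) * q ^ k).
  assert (He : forall k, d * q ^ k = e k - e (S k))
    by (intros k; unfold e; simpl; field; lra).
  assert (He0 : forall k, 0 <= e k).
  { intros k. unfold e. assert (0 <= d).
    { specialize (Ha 0%nat). rewrite pow_O, Rmult_1_r in Ha.
      eapply Rle_trans; [apply Rabs_pos|exact Ha]. }
    apply Rmult_le_pos; [apply Rdiv_le_0_compat; lra|apply pow_le; lra]. }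
  assert (Hstep : forall k, a k - e k <= a (S k) - e (S k) /\
                            a (S k) + e (S k) <= a k + e k).
  { intros k. specialize (Ha k). rewrite He in Ha.
    apply Rabs_le_between in Ha. lra. }
  assert (Hmono : forall k j, a k - e k <= a (k + j)%nat - e (k + j)%nat /\
                              a (k + j)%nat + e (k + j)%nat <= a k + e k).
  { intros k j. induction j as [|j IH].
    - rewrite Nat.add_0_r. lra.
    - rewrite Nat.add_succ_r. specialize (Hstep (k + j)%nat). lra. }
  assert (Hlu : forall k j, a k - e k <= a j + e j).
  { intros k j. assert (H1 := Hmono k j). assert (H2 := Hmono j k).
    rewrite (Nat.add_comm j k) in H2. specialize (He0 (k + j)%nat). lra. }
  destruct (completeness (fun x => exists k, x = a k - e k)) as [l [H1 H2]].
  - exists (a 0%nat + e 0%nat). intros x [k ->]. apply Hlu.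
  - now exists (a 0%nat - e 0%nat), 0%nat.
  - exists l. intros k. fold (e k). apply Rabs_le_between.
    assert (a k - e k <= l) by (apply H1; now exists k).
    assert (l <= a k + e k) by (apply H2; intros x [j ->]; apply Hlu). lra.
Qed.

Lemma le_0_of_geometric (x m q : R) : 0 <= q < 1 ->
  (forall k : nat, x <= m * q ^ k) -> x <= 0.
Proof.
  intros Hq H. apply Rnot_lt_le. intros Hx.
  assert (Hm : 0 < m) by (specialize (H 0%nat); simpl in H; lra).
  destruct (pow_lt_1_zero q) with (y := x / m) as [k Hk].
  - rewrite Rabs_right; lra.
  - now apply Rdiv_lt_0_compat.
  - specialize (Hk k (le_n k)). specialize (H k).
    apply Rabs_lt_between in Hk. destruct Hk as [_ Hk].
    apply (Rmult_lt_compat_l m) in Hk; trivial.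
    replace (m * (x / m)) with x in Hk by (field; lra). lra.
Qed.

(** Banach's fixed point theorem for [z |-> w - b conj(z)^n], which has the
    Lipschitz constant [n |b|] on the closed unit disk. *)
Lemma f_bn_solve (b : C) (n : nat) (z0 w : C) :
  let q := INR n * Cmod b in
  q < 1 -> Cmod z0 + Cmod (w - f_bn b n z0) / (1 - q) <= 1 ->
  exists z, Cmod (z - z0) <= Cmod (w - f_bn b n z0) / (1 - q) /\ f_bn b n z = w.
Proof.
  intros q Hq1. set (d := Cmod (w - f_bn b n z0)). intros Hz0.
  assert (Hq0 : 0 <= q) by (apply Rmult_le_pos; [apply pos_INR|apply Cmod_ge_0]).
  assert (Hd : 0 <= d) by apply Cmod_ge_0.
  set (T := fun z => (w - b * Cconj z ^ n)%C).
  assert (HT : forall x y, Cmod x <= 1 -> Cmod y <= 1 ->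
            Cmod (T x - T y) <= q * Cmod (x - y)).
  { intros x y Hx Hy. assert (H := conj_power_lipschitz b n 1 x y Hx Hy).
    rewrite pow1, Rmult_1_r in H. unfold T.
    replace (_ - _)%C with (- (b * (Cconj x ^ n - Cconj y ^ n)))%C by ring.
    now rewrite Cmod_opp. }
  set (u := fix u (k : nat) : C := match k with O => z0 | S k => T (u k) end).
  assert (Hqk : forall k, 0 <= q ^ k) by (intros k; now apply pow_le).
  assert (Hin : forall x, Cmod (x - z0) <= d / (1 - q) -> Cmod x <= 1).
  { intros x Hx. assert (H := Cmod_triangle (x - z0) z0).
    replace (x - z0 + z0)%C with x in H by ring. lra. }
  assert (Hu : forall k, Cmod (u k - z0) <= d / (1 - q) * (1 - q ^ k) /\
                         Cmod (u (S k) - u k) <= d * q ^ k).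
  { assert (Hle : forall k, d / (1 - q) * (1 - q ^ k) <= d / (1 - q)).
    { intros k. specialize (Hqk k).
      assert (0 <= d / (1 - q)) by (apply Rdiv_le_0_compat; lra). nra. }
    induction k as [|k [IH1 IH2]].
    - split.
      + simpl. replace (z0 - z0)%C with (RtoC 0) by ring. rewrite Cmod_0. lra.
      + apply Req_le. rewrite Rmult_1_r. unfold d. f_equal.
        simpl. unfold T, f_bn. ring.
    - assert (H1 : Cmod (u (S k) - z0) <= d / (1 - q) * (1 - q ^ S k)).
      { replace (u (S k) - z0)%C with ((u (S k) - u k) + (u k - z0))%C by ring.
        eapply Rle_trans; [apply Cmod_triangle|].
        replace (d / (1 - q) * (1 - q ^ S k))
          with (d * q ^ k + d / (1 - q) * (1 - q ^ k)) by (simpl; field; lra).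
        lra. }
      split; [exact H1|].
      assert (H2 := HT (u (S k)) (u k)).
      eapply Rle_trans; [apply H2; apply Hin|].
      + eapply Rle_trans; [exact H1|apply Hle].
      + eapply Rle_trans; [exact IH1|apply Hle].
      + simpl pow. nra. }
  destruct (geometric_limit (fun k => Re (u k)) d q) as [x Hx]; [lra| |].
  { intros k. eapply Rle_trans; [|apply Hu].
    eapply Rle_trans; [|apply re_le_Cmod]. apply Req_le. reflexivity. }
  destruct (geometric_limit (fun k => Im (u k)) d q) as [y Hy]; [lra| |].
  { intros k. eapply Rle_trans; [|apply Hu].
    eapply Rle_trans; [|apply im_le_Cmod]. apply Req_le. reflexivity. }
  set (z := (x, y) : C). set (m := 2 * (d / (1 - q))).
  assert (Hlim : forall k, Cmod (u k - z) <= m * q ^ k).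
  { intros k. eapply Rle_trans; [apply Cmod_le_abs|].
    specialize (Hx k). specialize (Hy k). unfold m.
    change (Re (u k - z)) with (Re (u k) - x).
    change (Im (u k - z)) with (Im (u k) - y). lra. }
  assert (Hz : Cmod (z - z0) <= d / (1 - q)).
  { cut (Cmod (z - z0) - d / (1 - q) <= 0); [lra|].
    apply (le_0_of_geometric _ m q); [lra|]. intros k.
    destruct (Hu k) as [H1 _]. specialize (Hlim k). specialize (Hqk k).
    assert (H := Cmod_triangle (- (u k - z)) (u k - z0)).
    replace (- (u k - z) + (u k - z0))%C with (z - z0)%C in H by ring.
    rewrite Cmod_opp in H.
    assert (0 <= d / (1 - q)) by (apply Rdiv_le_0_compat; lra). nra. }
  exists z. split; [exact Hz|].
  cut (Cmod (z - T z) <= 0).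
  { intros H. assert (H0 := Cmod_ge_0 (z - T z)).
    assert (H1 : Cmod (z - T z) = 0) by lra. apply Cmod_eq_0 in H1.
    unfold f_bn. unfold T in H1.
    replace w with (w + 0)%C by ring. rewrite <- H1. ring. }
  apply (le_0_of_geometric _ (2 * m) q); [lra|]. intros k.
  assert (H := Cmod_triangle (- (u (S k) - z)) (T (u k) - T z)).
  replace (- (u (S k) - z) + (T (u k) - T z))%C with (z - T z)%C in H
    by (simpl; ring).
  rewrite Cmod_opp in H.
  assert (H1 := Hlim (S k)). assert (H2 := Hlim k).
  assert (H3 := HT (u k) z).
  assert (Hm : 0 <= m) by (assert (0 <= d / (1 - q)) by (apply Rdiv_le_0_compat; lra);
                           unfold m; lra).
  assert (Hmq : 0 <= m * q ^ k) by now apply Rmult_le_pos.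
  assert (H4 : Cmod (T (u k) - T z) <= q * Cmod (u k - z)).
  { apply H3; apply Hin; trivial. eapply Rle_trans; [apply Hu|].
    specialize (Hqk k).
    assert (0 <= d / (1 - q)) by (apply Rdiv_le_0_compat; lra). nra. }
  simpl pow in H1. nra.
Qed.

(** With [J] the Jacobian of [f = f_bn b n], this is [J] times the derivative of
    [|z|^2 / 2] along the inverse of [f] in the direction [k]: the
    differential [h |-> h + c conj(h)], [c = n b conj(z)^(n-1)], has the inverse
    [k |-> (k - c conj(k)) / (1 - |c|^2)]. *)
Definition radial_form (b : C) (n : nat) (z k : C) : R :=
  Re (Cconj z * (k - INR n * b * Cconj z ^ pred n * Cconj k)).

Lemma radial_form_plus (b : C) (n : nat) (z k l : C) :
  radial_form b n z (k + l) = radial_form b n z k + radial_form b n z l.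
Proof.
  unfold radial_form. rewrite Cplus_conj.
  match goal with |- _ = Re ?x + Re ?y => change (Re x + Re y) with (Re (x + y)%C) end.
  f_equal. ring.
Qed.

Lemma radial_form_scal (b : C) (n : nat) (z k : C) (s : R) :
  radial_form b n z (s * k) = s * radial_form b n z k.
Proof.
  unfold radial_form. rewrite Cmult_conj.
  replace (Cconj s) with (RtoC s) by (unfold Cconj, RtoC; simpl; f_equal; ring).
  replace (_ * _)%C with (s * (Cconj z * (k - INR n * b * Cconj z ^ pred n * Cconj k)))%C
    by ring.
  unfold Cmult, RtoC, Re; simpl. ring.
Qed.

Lemma radial_form_bound (b : C) (n : nat) (z k : C) : Cmod z <= 1 ->
  Rabs (radial_form b n z k) <= (1 + INR n * Cmod b) * Cmod k.
Proof.
  intros Hz. eapply Rle_trans; [apply re_le_Cmod|]. rewrite Cmod_mult, Cmod_conj.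
  assert (H : Cmod (k - INR n * b * Cconj z ^ pred n * Cconj k)
              <= (1 + INR n * Cmod b) * Cmod k).
  { eapply Rle_trans; [apply Cmod_triangle|]. rewrite Cmod_opp, !Cmod_mult, Cmod_conj, Cmod_R.
    assert (Hp := Cmod_pow_le_1 (Cconj z) (pred n)). rewrite Cmod_conj in Hp.
    specialize (Hp Hz). assert (Hn := pos_INR n). rewrite Rabs_right by lra.
    assert (H1 := Cmod_ge_0 b). assert (H2 := Cmod_ge_0 k).
    assert (H3 : 0 <= INR n * Cmod b * Cmod k) by (repeat apply Rmult_le_pos; trivial).
    assert (H4 := Cmod_ge_0 (Cconj z ^ pred n)). nra. }
  assert (H0 := Cmod_ge_0 z).
  assert (H1 := Cmod_ge_0 (k - INR n * b * Cconj z ^ pred n * Cconj k)). nra.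
Qed.

Lemma radial_form_differential (b : C) (n : nat) (z h : C) :
  radial_form b n z (h + INR n * b * Cconj z ^ pred n * Cconj h)
  = (1 - (INR n * Cmod b * Cmod z ^ pred n) ^ 2) * Re (Cconj z * h).
Proof.
  unfold radial_form. set (c := (INR n * b * Cconj z ^ pred n)%C).
  assert (Hc : Cmod c = INR n * Cmod b * Cmod z ^ pred n).
  { unfold c. rewrite !Cmod_mult, Cmod_R, Cmod_pow, Cmod_conj, Rabs_right; trivial.
    apply Rle_ge, pos_INR. }
  rewrite <- Hc, Cplus_conj, Cmult_conj, Cconj_conj.
  replace (Cconj z * _)%C with ((1 - c * Cconj c) * (Cconj z * h))%C by ring.
  rewrite <- Cmod2_conj. unfold Cmult, Cminus, Cplus, Copp, RtoC, Re; simpl. ring.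
Qed.

(** The main expansion: if [f] maps the displacement [h] of [z] to the
    displacement along the spiral from [f z] in the direction [- mu], then to
    first order [Re (conj z h)] is governed by [radial_form]. *)
Lemma spiral_step_expansion (b : C) (n : nat) (z h mu : C) (s K : R) :
  Cmod z <= 1 -> Cmod (z + h) <= 1 -> Cmod mu <= 1 -> 0 <= s <= 1 / 2 ->
  Cmod h <= K * s ->
  f_bn b n (z + h) = (f_bn b n z * Cexp (- s * mu))%C ->
  Rabs ((1 - (INR n * Cmod b * Cmod z ^ pred n) ^ 2) * Re (Cconj z * h)
        + s * radial_form b n z (f_bn b n z * mu))
  <= (1 + INR n * Cmod b)
     * (Cmod b * INR n ^ 2 * K ^ 2 + (1 + Cmod b) * 5) * s ^ 2.
Proof.
  intros Hz Hzh Hmu Hs Hh Hf. rewrite (Rmult_assoc (1 + INR n * Cmod b)). set (w := f_bn b n z) in *.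
  set (e1 := (b * ((Cconj z + Cconj h) ^ n - Cconj z ^ n
                   - INR n * Cconj z ^ pred n * Cconj h))%C).
  set (e2 := (w * (Cexp (- s * mu) - 1 - (- s * mu)))%C).
  (* [e1] and [e2] are the remainders of the expansions of [f (z + h)] and of
     the exponential. *)
  assert (He : (h + INR n * b * Cconj z ^ pred n * Cconj h + s * (w * mu)
               = e2 + - e1)%C).
  { replace (e2 + - e1)%C
      with (w * Cexp (- s * mu) - w + s * (w * mu) + - e1)%C
      by (unfold e2; ring).
    rewrite <- Hf. unfold w, e1, f_bn. rewrite Cplus_conj. ring. }
  rewrite <- radial_form_differential, <- radial_form_scal, <- radial_form_plus, He.
  eapply Rle_trans; [apply radial_form_bound; assumption|].
  apply Rmult_le_compat_l.
  { assert (0 <= INR n * Cmod b) by (apply Rmult_le_pos; [apply pos_INR|apply Cmod_ge_0]). lra. }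
  eapply Rle_trans; [apply Cmod_triangle|].
  rewrite Cmod_opp, Rplus_comm, Rmult_plus_distr_r.
  assert (Hb := Cmod_ge_0 b).
  apply Rplus_le_compat.
  - assert (Hh2 : Cmod h ^ 2 <= K ^ 2 * s ^ 2).
    { rewrite <- Rpow_mult_distr. apply pow_incr.
      split; [apply Cmod_ge_0|exact Hh]. }
    unfold e1. rewrite Cmod_mult, !Rmult_assoc. apply Rmult_le_compat_l; trivial.
    eapply Rle_trans; [|apply Rmult_le_compat_l; [apply pow2_ge_0|exact Hh2]].
    rewrite <- (Cmod_conj h). apply Cpow_taylor; [now rewrite Cmod_conj|].
    now rewrite <- Cplus_conj, Cmod_conj.
  - unfold e2. rewrite Cmod_mult, Rmult_assoc.
    assert (Hsm : Cmod (- s * mu) <= s).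
    { rewrite Cmod_mult, Cmod_opp, Cmod_R, Rabs_right by lra.
      assert (H0 := Cmod_ge_0 mu). nra. }
    apply Rmult_le_compat; try apply Cmod_ge_0.
    + unfold w, f_bn. eapply Rle_trans; [apply Cmod_triangle|].
      rewrite Cmod_mult. assert (Hp := Cmod_pow_le_1 (Cconj z) n).
      rewrite Cmod_conj in Hp. specialize (Hp Hz). nra.
    + eapply Rle_trans; [apply Cexp_taylor; lra|].
      assert (H0 := Cmod_ge_0 (- s * mu)). nra.
Qed.

(** * The sign of the radial form along a spiral *)

(** In this form the first term depends on [z] through [|z|] only, and the
    second one is a multiple of [conj(z)^(n+1)], whose argument is arbitrary. *)
Lemma radial_form_spiral (b : C) (n : nat) (z mu : C) : (1 <= n)%nat ->
  radial_form b n z (f_bn b n z * mu)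
  = Re mu * (Cmod z ^ 2 - INR n * (Cmod b * Cmod z ^ n) ^ 2)
    + Re (b * Cconj z ^ S n * (mu - INR n * Cconj mu)).
Proof.
  intros Hn. unfold radial_form, f_bn. set (beta := (b * Cconj z ^ n)%C).
  assert (Hbeta : Cmod beta = Cmod b * Cmod z ^ n).
  { unfold beta. now rewrite Cmod_mult, Cmod_pow, Cmod_conj. }
  rewrite <- Hbeta, Cmult_conj, Cplus_conj.
  replace (b * Cconj z ^ S n)%C with (Cconj z * beta)%C
    by (unfold beta; simpl; ring).
  replace (Cconj z * _)%C
    with (z * Cconj z * mu - INR n * (beta * Cconj beta) * Cconj mu
          + Cconj z * beta * (mu - INR n * Cconj mu))%C.
  2:{ unfold beta. destruct n as [|n]; [lia|]. simpl. ring. }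
  rewrite <- !Cmod2_conj. set (v := (Cconj z * beta * _)%C).
  unfold Cmult, Cminus, Cplus, Copp, Cconj, RtoC, Re; simpl. ring.
Qed.

(** The common value of [|mu - n conj(mu)|] for unit [mu] with real part [s],
    and of the modulus [|n + exp (i PI alpha)|] in [C_n], for
    [s = sin (PI alpha / 2)]. *)
Definition spiral_modulus (n : nat) (s : R) : R :=
  sqrt ((INR n + 1) ^ 2 - 4 * INR n * s ^ 2).

Lemma spiral_modulus_radicand (n : nat) (s : R) : -1 <= s <= 1 ->
  (INR n - 1) ^ 2 <= (INR n + 1) ^ 2 - 4 * INR n * s ^ 2.
Proof.
  intros Hs. assert (Hn := pos_INR n). assert (s ^ 2 <= 1) by nra. nra.
Qed.

Lemma Cmod_direction (n : nat) (mu : C) : Cmod mu = 1 ->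
  Cmod (mu - INR n * Cconj mu) = spiral_modulus n (Re mu).
Proof.
  intros H. unfold spiral_modulus.
  rewrite <- (sqrt_pow2 (Cmod (mu - INR n * Cconj mu))) by apply Cmod_ge_0. f_equal.
  assert (H2 := Cmod2_alt mu). rewrite H in H2. rewrite Cmod2_alt.
  destruct mu as [x y]; unfold Cmult, Cminus, Cplus, Copp, Cconj, RtoC, Re, Im in *;
    simpl in *.
  transitivity ((1 - INR n) ^ 2 * (x * (x * 1)) + (1 + INR n) ^ 2 * (y * (y * 1)));
    [ring|].
  replace (y * (y * 1)) with (1 - x * (x * 1)) by lra. ring.
Qed.

Lemma C_n_spiral_modulus (n : nat) (alpha : R) :
  C_n n alpha = 2 * sin (PI * alpha / 2)
                / (INR n + 1 + spiral_modulus n (sin (PI * alpha / 2))).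
Proof.
  unfold C_n, spiral_modulus. do 2 f_equal.
  rewrite <- (sqrt_pow2 (Cmod _)) by apply Cmod_ge_0. f_equal.
  rewrite Cmod2_alt.
  replace (Ci * (PI * alpha))%C with ((0, PI * alpha) : C)
    by (unfold Ci, Cmult, RtoC; simpl; f_equal; ring).
  unfold Cexp, Cplus, RtoC, Re, Im; simpl. rewrite exp_0.
  assert (H := sin2_cos2 (PI * alpha)). unfold Rsqr in H.
  assert (Hc : cos (PI * alpha) = 1 - 2 * sin (PI * alpha / 2) * sin (PI * alpha / 2)).
  { rewrite <- cos_2a_sin. f_equal. field. }
  nra.
Qed.

(** With [A = spiral_modulus n s] and [D = n + 1 + A], [C_n = 2 s / D] is the
    positive root of [s (1 - n x^2) - x A]: since [4 n s^2 = (n + 1 - A) D],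
    this polynomial is [(C_n - x) (n s x + D / 2)]. *)
Lemma C_n_root (n : nat) (alpha x : R) : (1 <= n)%nat -> 0 < alpha < 1 -> 0 <= x ->
  let s := sin (PI * alpha / 2) in
  x <= C_n n alpha <-> 0 <= s * (1 - INR n * x ^ 2) - x * spiral_modulus n s.
Proof.
  intros Hn Ha Hx s. rewrite C_n_spiral_modulus. fold s.
  assert (Hpi := PI_RGT_0).
  assert (Hs : 0 < s) by (apply sin_gt_0; nra).
  assert (Hs1 := SIN_bound (PI * alpha / 2)). fold s in Hs1.
  assert (Hn1 : 1 <= INR n) by (apply (le_INR 1); exact Hn).
  assert (Hrad := spiral_modulus_radicand n s ltac:(lra)).
  assert (HA0 : 0 <= spiral_modulus n s) by apply sqrt_pos.
  assert (HA : spiral_modulus n s ^ 2 = (INR n + 1) ^ 2 - 4 * INR n * s ^ 2).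
  { unfold spiral_modulus. apply pow2_sqrt. assert (H := pow2_ge_0 (INR n - 1)). lra. }
  set (A := spiral_modulus n s) in *. set (D := INR n + 1 + A).
  assert (HD : 0 < D) by (unfold D; lra).
  assert (E : s * (1 - INR n * x ^ 2) - x * A
              = (2 * s / D - x) * (INR n * s * x + D / 2)).
  { assert (HA' : 4 * INR n * s ^ 2 = (INR n + 1 - A) * D)
      by (unfold D; nra).
    transitivity (s - INR n * s * x ^ 2 + x * ((4 * INR n * s ^ 2) / (2 * D) - D / 2));
      [rewrite HA'; unfold D; field; unfold D in HD; lra|field; lra]. }
  assert (HF : 0 < INR n * s * x + D / 2).
  { assert (0 <= INR n * s * x) by (repeat apply Rmult_le_pos; lra). lra. }
  rewrite E. split; intros H; [apply Rmult_le_pos; lra|].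
  apply Rnot_lt_le. intros Hlt. nra.
Qed.

(** Estimating the last term of [radial_form_spiral] by its modulus leaves
    [|z|^2 (s (1 - n x^2) - x A)] with [x = |b| |z|^(n-1)] and
    [A = spiral_modulus n s], whose sign is given by [C_n_root]. *)
Lemma radial_form_nonneg (b : C) (n : nat) (alpha : R) (z mu : C) :
  (1 <= n)%nat -> 0 < alpha < 1 -> Cmod b <= C_n n alpha ->
  Cmod mu = 1 -> Re mu = sin (PI * alpha / 2) -> Cmod z <= 1 ->
  0 <= radial_form b n z (f_bn b n z * mu).
Proof.
  intros Hn Ha Hb Hmu Hre Hz. rewrite radial_form_spiral, Hre by exact Hn.
  set (s := sin (PI * alpha / 2)) in *.
  set (v := (b * Cconj z ^ S n * (mu - INR n * Cconj mu))%C).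
  assert (Hv : Cmod v = Cmod b * Cmod z ^ S n * spiral_modulus n s).
  { unfold v. rewrite !Cmod_mult, Cmod_pow, Cmod_conj, Cmod_direction, Hre by exact Hmu.
    reflexivity. }
  assert (Hv' := re_le_Cmod v). apply Rabs_le_between in Hv'. rewrite Hv in Hv'.
  assert (Hz0 := Cmod_ge_0 z). assert (Hb0 := Cmod_ge_0 b).
  set (x := Cmod b * Cmod z ^ pred n).
  assert (Hp : 0 <= Cmod z ^ pred n <= 1).
  { apply pow_le_1. lra. }
  assert (Hx : 0 <= x <= Cmod b) by (unfold x; split; nra).
  destruct (C_n_root n alpha x Hn Ha ltac:(lra)) as [H _].
  specialize (H ltac:(lra)). cbv zeta in H. fold s in H.
  assert (Hzn : Cmod b * Cmod z ^ n = x * Cmod z)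
    by (unfold x; destruct n; [lia|simpl; ring]).
  assert (HzS : Cmod b * Cmod z ^ S n = x * Cmod z ^ 2)
    by (change (Cmod z ^ S n) with (Cmod z * Cmod z ^ n); nra).
  rewrite Hzn. rewrite HzS in Hv'.
  assert (H2 : 0 <= Cmod z ^ 2 * (s * (1 - INR n * x ^ 2) - x * spiral_modulus n s))
    by (apply Rmult_le_pos; [apply pow2_ge_0|exact H]).
  nra.
Qed.

(** Under the bound, [z |-> b conj(z)^n] is therefore a strict contraction on
    the unit disk. The inequality holds because
    [spiral_modulus n s >= n - 1] and [s = sin (PI alpha / 2) < 1]. *)
Lemma C_n_lt_inv (n : nat) (alpha : R) : (1 <= n)%nat -> 0 < alpha < 1 ->
  INR n * C_n n alpha < 1.
Proof.
  intros Hn Ha. rewrite C_n_spiral_modulus.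
  assert (Hpi := PI_RGT_0). set (s := sin (PI * alpha / 2)).
  assert (Hs : s < 1).
  { unfold s. rewrite <- sin_PI2. apply sin_increasing_1; nra. }
  assert (Hs0 : 0 < s) by (apply sin_gt_0; nra).
  assert (Hn1 : 1 <= INR n) by (apply (le_INR 1); exact Hn).
  assert (HA : INR n - 1 <= spiral_modulus n s).
  { unfold spiral_modulus. rewrite <- (sqrt_pow2 (INR n - 1)) by lra.
    apply sqrt_le_1_alt, spiral_modulus_radicand. lra. }
  replace (INR n * (2 * s / (INR n + 1 + spiral_modulus n s)))
    with (2 * s * INR n / (INR n + 1 + spiral_modulus n s)) by (field; lra).
  apply Rlt_div_l; [lra|]. nra.
Qed.

(** * Spirals stay in the images of the disks *)

Lemma Cmod_f_bn_le (b : C) (n : nat) (z : C) : Cmod z <= 1 ->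
  Cmod (f_bn b n z) <= 1 + Cmod b.
Proof.
  intros Hz. unfold f_bn. eapply Rle_trans; [apply Cmod_triangle|].
  rewrite Cmod_mult. assert (Hp := Cmod_pow_le_1 (Cconj z) n).
  rewrite Cmod_conj in Hp. specialize (Hp Hz). assert (Hb := Cmod_ge_0 b). nra.
Qed.

Lemma spiral_displacement (w mu : C) (s : R) : Cmod mu <= 1 -> 0 <= s <= 1 / 2 ->
  Cmod (w * Cexp (- s * mu) - w) <= Cmod w * (4 * s).
Proof.
  intros Hmu Hs. replace (w * Cexp (- s * mu) - w)%C
    with (w * (Cexp (- s * mu) - 1))%C by ring.
  rewrite Cmod_mult. apply Rmult_le_compat_l; [apply Cmod_ge_0|].
  replace (Cexp (- s * mu) - 1)%C
    with ((Cexp (- s * mu) - 1 - (- s * mu)) + (- s * mu))%C by ring.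
  eapply Rle_trans; [apply Cmod_triangle|].
  assert (Hsm : Cmod (- s * mu) <= s).
  { rewrite Cmod_mult, Cmod_opp, Cmod_R, Rabs_right by lra. nra. }
  assert (H := Cexp_taylor (- s * mu) ltac:(lra)).
  assert (H0 := Cmod_ge_0 (- s * mu)). nra.
Qed.

Lemma Cmod_plus_sq (z h : C) :
  Cmod (z + h) ^ 2 = Cmod z ^ 2 + 2 * Re (Cconj z * h) + Cmod h ^ 2.
Proof.
  rewrite !Cmod2_alt. destruct z, h; unfold Cmult, Cplus, Cconj, Re, Im; simpl. ring.
Qed.

(** One step inwards along the spiral raises [|z|^2] at most to second order in
    its length [s], with constants that do not depend on [z]. *)
Lemma spiral_step (b : C) (n : nat) (mu : C) :
  INR n * Cmod b < 1 -> Cmod mu <= 1 ->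
  (forall z, Cmod z <= 1 -> 0 <= radial_form b n z (f_bn b n z * mu)) ->
  exists K L, 0 <= K /\ 0 <= L /\
    forall z s, 0 <= s <= 1 / 2 -> Cmod z + K * s <= 1 ->
    exists z', f_bn b n z' = (f_bn b n z * Cexp (- s * mu))%C /\
      Cmod z' ^ 2 <= Cmod z ^ 2 + L * s ^ 2.
Proof.
  intros Hq Hmu Hpos. set (q := INR n * Cmod b) in *.
  assert (Hb := Cmod_ge_0 b). assert (Hn := pos_INR n).
  assert (Hq0 : 0 <= q) by now apply Rmult_le_pos.
  set (K := 4 * (1 + Cmod b) / (1 - q)).
  assert (HK : 0 <= K) by (apply Rdiv_le_0_compat; lra).
  set (M := (1 + q) * (Cmod b * INR n ^ 2 * K ^ 2 + (1 + Cmod b) * 5)).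
  assert (HM : 0 <= M).
  { apply Rmult_le_pos; [lra|]. apply Rplus_le_le_0_compat; [|lra].
    apply Rmult_le_pos; [|apply pow2_ge_0].
    apply Rmult_le_pos; [exact Hb|apply pow2_ge_0]. }
  assert (Hq2 : 0 < 1 - q ^ 2) by nra.
  set (L := 2 * (M / (1 - q ^ 2)) + K ^ 2).
  assert (HL : 0 <= M / (1 - q ^ 2)) by (apply Rdiv_le_0_compat; lra).
  exists K, L. split; [exact HK|]. split; [unfold L; nra|].
  intros z s Hs Hz. assert (HKs : 0 <= K * s) by (apply Rmult_le_pos; lra).
  set (w := (f_bn b n z * Cexp (- s * mu))%C).
  assert (Hd : Cmod (w - f_bn b n z) / (1 - q) <= K * s).
  { replace (K * s) with ((1 + Cmod b) * (4 * s) / (1 - q)) by (unfold K; field; lra).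
    apply Rmult_le_compat_r; [left; apply Rinv_0_lt_compat; lra|].
    eapply Rle_trans; [apply spiral_displacement; assumption|].
    apply Rmult_le_compat_r; [lra|]. apply Cmod_f_bn_le. lra. }
  destruct (f_bn_solve b n z w Hq) as [z' [Hz' Hf]]; [fold q; lra|]. fold q in Hz'.
  exists z'. split; [exact Hf|].
  set (h := (z' - z)%C). assert (Hh : Cmod h <= K * s) by (unfold h; lra).
  assert (Ez : z' = (z + h)%C) by (unfold h; ring).
  assert (Hz1 : Cmod (z + h) <= 1)
    by (eapply Rle_trans; [apply Cmod_triangle|lra]).
  rewrite Ez in Hf.
  assert (Hexp := spiral_step_expansion b n z h mu s K ltac:(lra) Hz1 Hmu Hs Hh Hf).
  fold q M in Hexp. specialize (Hpos z ltac:(lra)).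
  set (P := radial_form _ _ _ _) in *. set (c := q * Cmod z ^ pred n) in *.
  assert (Hc : 0 <= c <= q).
  { assert (0 <= Cmod z ^ pred n <= 1); [|unfold c; split; nra].
    apply pow_le_1. split; [apply Cmod_ge_0|lra]. }
  apply Rabs_le_between in Hexp.
  assert (HsP : 0 <= s * P) by (apply Rmult_le_pos; lra).
  assert (Hr : Re (Cconj z * h) <= M / (1 - q ^ 2) * s ^ 2).
  { apply Rnot_lt_le. intros Hlt.
    assert (H1 : 0 <= M / (1 - q ^ 2) * s ^ 2)
      by (apply Rmult_le_pos; [exact HL|apply pow2_ge_0]).
    assert (H2 : (1 - q ^ 2) * Re (Cconj z * h) <= (1 - c ^ 2) * Re (Cconj z * h))
      by (apply Rmult_le_compat_r; [lra|]; assert (c ^ 2 <= q ^ 2) by (now apply pow_incr);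
          lra).
    assert (H3 : (1 - q ^ 2) * (M / (1 - q ^ 2) * s ^ 2) = M * s ^ 2) by (field; lra).
    apply (Rmult_lt_compat_l (1 - q ^ 2)) in Hlt; [|exact Hq2]. lra. }
  assert (Hh2 : Cmod h ^ 2 <= K ^ 2 * s ^ 2).
  { rewrite <- Rpow_mult_distr. apply pow_incr. split; [apply Cmod_ge_0|exact Hh]. }
  rewrite Ez, Cmod_plus_sq. unfold L. lra.
Qed.

(** As in Euler's polygonal method, [N] steps of length [T / N] raise [|z|^2] by
    at most [L T^2 / N], which tends to [0]. *)
Lemma spiral_invariance (b : C) (n : nat) (mu : C) :
  INR n * Cmod b < 1 -> Cmod mu <= 1 ->
  (forall z, Cmod z <= 1 -> 0 <= radial_form b n z (f_bn b n z * mu)) ->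
  forall r T w, 0 < r < 1 -> 0 <= T -> image (f_bn b n) (disk r) w ->
  image (f_bn b n) (disk r) (w * Cexp (- T * mu))%C.
Proof.
  intros Hq Hmu Hpos r T w Hr HT [z0 [Hz0 ->]]. unfold disk in Hz0.
  destruct (spiral_step b n mu Hq Hmu Hpos) as [K [L [HK [HL Hstep]]]].
  assert (H0 := Cmod_ge_0 z0).
  set (g := r ^ 2 - Cmod z0 ^ 2). assert (Hg : 0 < g) by (unfold g; nra).
  assert (X1 : 0 <= K * T / (1 - r)) by (apply Rdiv_le_0_compat; nra).
  assert (X2 : 0 <= L * T ^ 2 / g) by (apply Rdiv_le_0_compat; nra).
  destruct (INR_unbounded (1 + 2 * T + K * T / (1 - r) + L * T ^ 2 / g)) as [N HN].
  set (s := T / INR N).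
  assert (HN0 : 0 < INR N) by lra.
  assert (HsN : INR N * s = T) by (unfold s; field; lra).
  assert (Hs : 0 <= s <= 1 / 2).
  { split; [apply Rdiv_le_0_compat; lra|]. unfold s. apply Rle_div_l; [lra|]. lra. }
  assert (HKs : K * s <= 1 - r).
  { unfold s. replace (K * (T / INR N)) with ((K * T) / INR N) by (field; lra).
    apply Rle_div_l; [lra|].
    replace (K * T) with ((1 - r) * (K * T / (1 - r))) by (field; lra).
    apply Rmult_le_compat_l; lra. }
  assert (HLs : INR N * (L * s ^ 2) < g).
  { replace (INR N * (L * s ^ 2)) with (g * (L * T ^ 2 / g) / INR N)
      by (unfold s; field; lra).
    apply Rlt_div_l; [lra|]. apply Rmult_lt_compat_l; lra. }
  assert (HLs0 : 0 <= L * s ^ 2) by nra.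
  assert (Hiter : forall k, (k <= N)%nat -> exists z,
    f_bn b n z = (f_bn b n z0 * Cexp (- (INR k * s)%R * mu))%C /\
    Cmod z ^ 2 <= Cmod z0 ^ 2 + INR k * (L * s ^ 2)).
  { assert (Hin : forall k z, (k <= N)%nat ->
              Cmod z ^ 2 <= Cmod z0 ^ 2 + INR k * (L * s ^ 2) -> Cmod z < r).
    { intros k z Hk Hz. apply le_INR in Hk.
      assert (H1 : INR k * (L * s ^ 2) <= INR N * (L * s ^ 2))
        by (apply Rmult_le_compat_r; assumption).
      assert (H2 := Cmod_ge_0 z). unfold g in HLs.
      apply Rnot_le_lt. intros H3. nra. }
    induction k as [|k IH]; intros Hk.
    - exists z0. simpl INR. split; [|lra].
      replace (- (0 * s)%R * mu)%C with (RtoC 0).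
      + rewrite Cexp_0. ring.
      + rewrite Rmult_0_l. ring.
    - destruct IH as [z [Hz1 Hz2]]; [lia|].
      assert (Hzr := Hin k z ltac:(lia) Hz2).
      destruct (Hstep z s Hs ltac:(lra)) as [z' [Hz1' Hz2']].
      exists z'. rewrite S_INR. split; [|lra].
      rewrite Hz1', Hz1, <- Cmult_assoc, <- Cexp_add. do 2 f_equal.
      rewrite !RtoC_mult, RtoC_plus. ring. }
  destruct (Hiter N (le_n N)) as [z [Hz1 Hz2]]. exists z. split.
  - unfold disk. assert (H2 := Cmod_ge_0 z). unfold g in HLs.
    apply Rnot_le_lt. intros H3. nra.
  - rewrite Hz1, HsN. reflexivity.
Qed.

(** * Necessity of the bound *)

(** The point at distance [s] inwards along the spiral from [f z0] has its
    preimage in the disk of radius [|z0| + s^2], so that [Re (conj z0 h)] is at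
    most of order [s^2]; dividing the expansion by [s] and letting [s] tend to
    [0] gives the sign. *)
Lemma radial_form_of_spirals (b : C) (n : nat) (mu z0 : C) :
  (forall rho, 0 <= rho < 1 -> INR n * Cmod b * rho ^ pred n < 1) ->
  Cmod mu <= 1 -> Cmod z0 < 1 ->
  (forall r s, Cmod z0 < r < 1 -> 0 <= s ->
     image (f_bn b n) (disk r) (f_bn b n z0 * Cexp (- s * mu))%C) ->
  0 <= radial_form b n z0 (f_bn b n z0 * mu).
Proof.
  intros Hq Hmu Hz0 Himg. set (r := Cmod z0) in *.
  assert (Hr0 : 0 <= r) by apply Cmod_ge_0.
  assert (Hb := Cmod_ge_0 b). assert (Hn := pos_INR n).
  (* On the disk of radius [r1] the map has the lower Lipschitz constant [kap];
     [s] is taken so small that [r + s^2 < r1]. *)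
  set (r1 := (1 + r) / 2). assert (HR : r < r1 < 1) by (unfold r1; lra).
  set (kap := 1 - INR n * Cmod b * r1 ^ pred n).
  assert (Hkap : 0 < kap) by (unfold kap; specialize (Hq r1 ltac:(lra)); lra).
  set (K := 4 * (1 + Cmod b) / kap).
  assert (HK : 0 <= K) by (apply Rdiv_le_0_compat; lra).
  set (M := (1 + INR n * Cmod b) * (Cmod b * INR n ^ 2 * K ^ 2 + (1 + Cmod b) * 5)).
  assert (HM : 0 <= M).
  { apply Rmult_le_pos; [nra|]. apply Rplus_le_le_0_compat; [|lra].
    apply Rmult_le_pos; [|apply pow2_ge_0].
    apply Rmult_le_pos; [exact Hb|apply pow2_ge_0]. }
  set (P := radial_form _ _ _ _).
  assert (Hlow : forall s, 0 < s <= 1 / 2 -> s ^ 2 <= (1 - r) / 4 ->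
            - (M + 2) * s <= P).
  { intros s Hs Hsr.
    destruct (Himg (r + s ^ 2) s) as [z [Hz Hf]]; [split; nra|lra|].
    unfold disk in Hz. set (h := (z - z0)%C).
    assert (Ez : z = (z0 + h)%C) by (unfold h; ring).
    assert (HzR : Cmod z <= r1) by (unfold r1; lra).
    assert (Hh : Cmod h <= K * s).
    { assert (H := f_bn_lower_lipschitz b n r1 z z0 HzR ltac:(unfold r in *; lra)).
      fold kap in H. rewrite <- Hf in H.
      assert (H1 := spiral_displacement (f_bn b n z0) mu s Hmu ltac:(lra)).
      assert (H2 := Cmod_f_bn_le b n z0 ltac:(unfold r in *; lra)).
      replace (K * s) with ((1 + Cmod b) * (4 * s) / kap) by (unfold K; field; lra).
      apply Rle_div_r; [lra|]. unfold h. nra. }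
    symmetry in Hf. rewrite Ez in Hf, Hz, HzR.
    assert (Hexp := spiral_step_expansion b n z0 h mu s K ltac:(unfold r in *; lra)
                      ltac:(lra) Hmu ltac:(lra) Hh Hf).
    fold P r M in Hexp. specialize (Hq r ltac:(lra)).
    set (c := INR n * Cmod b * r ^ pred n) in *.
    assert (Hc : 0 <= c)
      by (unfold c; repeat apply Rmult_le_pos; trivial; now apply pow_le).
    apply Rabs_le_between in Hexp.
    assert (Hre : Re (Cconj z0 * h) <= 2 * s ^ 2).
    { assert (H := Cmod_plus_sq z0 h). fold r in H.
      assert (H1 : Cmod (z0 + h) ^ 2 <= (r + s ^ 2) ^ 2)
        by (apply pow_incr; split; [apply Cmod_ge_0|lra]).
      assert (H2 := pow2_ge_0 (Cmod h)).
      assert (H3 : s ^ 2 <= 1) by nra. assert (H4 : 0 <= s ^ 2) by nra. nra. }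
    assert (Hc2 : (1 - c ^ 2) * Re (Cconj z0 * h) <= 2 * s ^ 2).
    { assert (0 <= 1 - c ^ 2 <= 1) by nra. assert (0 <= s ^ 2) by nra.
      destruct (Rle_dec 0 (Re (Cconj z0 * h))); nra. }
    assert (H1 : - (M + 2) * s * s <= P * s) by nra.
    apply Rmult_le_reg_r in H1; lra. }
  apply Rnot_lt_le. intros HP.
  set (s := Rmin (1 / 2) (Rmin ((1 - r) / 4) (- P / (2 * (M + 2))))).
  assert (H1 : 0 < - P / (2 * (M + 2))) by (apply Rdiv_lt_0_compat; lra).
  assert (Hs : 0 < s) by (unfold s; repeat apply Rmin_pos; lra).
  assert (Hs1 : s <= 1 / 2) by apply Rmin_l.
  assert (Hs2 : s <= (1 - r) / 4)
    by (eapply Rle_trans; [apply Rmin_r|apply Rmin_l]).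
  assert (Hs3 : s <= - P / (2 * (M + 2)))
    by (eapply Rle_trans; [apply Rmin_r|apply Rmin_r]).
  specialize (Hlow s ltac:(lra) ltac:(nra)).
  apply (Rmult_le_compat_l (M + 2)) in Hs3; [|lra].
  replace ((M + 2) * (- P / (2 * (M + 2)))) with (- P / 2) in Hs3 by (field; lra).
  lra.
Qed.

Lemma Cexp_pow (z : C) (m : nat) : (Cexp z ^ m)%C = Cexp (INR m * z).
Proof.
  induction m as [|m IH].
  - simpl. replace (0 * z)%C with (RtoC 0) by ring. now rewrite Cexp_0.
  - rewrite S_INR, RtoC_plus. simpl Cpow. rewrite IH, <- Cexp_add. f_equal. ring.
Qed.

Lemma rotate_to_negative (k : C) (m : nat) : (1 <= m)%nat ->
  exists u, Cmod u = 1 /\ (k * u ^ m)%C = RtoC (- Cmod k).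
Proof.
  intros Hm. destruct (Ceq_dec k 0%C) as [->|Hk].
  - exists 1%C. split; [apply Cmod_1|]. rewrite Cmod_0, Ropp_0. ring.
  - destruct (polar_form k Hk) as [t [_ Ht]].
    assert (Hm' : INR m <> 0) by (apply not_0_INR; lia).
    exists (Cexp (0, (PI - t) / INR m)). split.
    + rewrite Cmod_Cexp. apply exp_0.
    + rewrite Cexp_pow. rewrite Ht at 1. rewrite <- Cexp_add.
      replace ((ln (Cmod k), t) + INR m * (0, ((PI - t) / INR m)%R))%C
        with ((ln (Cmod k), PI) : C).
      * unfold Cexp, RtoC; simpl. rewrite cos_PI, sin_PI, exp_ln by now apply Cmod_gt_0.
        f_equal; ring.
      * unfold Cplus, Cmult, RtoC; simpl. f_equal; field; exact Hm'.
Qed.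

(** The argument of [z] is chosen such that the last term of
    [radial_form_spiral] is real and nonpositive, and [|z|] tends to [1]. *)
Lemma bound_of_radial_form (b : C) (n : nat) (alpha : R) (mu : C) :
  (1 <= n)%nat -> 0 < alpha < 1 ->
  Cmod mu = 1 -> Re mu = sin (PI * alpha / 2) ->
  (forall z : C, z <> 0%C -> Cmod z < 1 -> 0 <= radial_form b n z (f_bn b n z * mu)) ->
  Cmod b <= C_n n alpha.
Proof.
  intros Hn Ha Hmu Hre Hpos. set (s := sin (PI * alpha / 2)) in *.
  destruct (rotate_to_negative (b * (mu - INR n * Cconj mu)) (S n)) as [u [Hu Hk]];
    [lia|].
  rewrite Cmod_mult, Cmod_direction, Hre in Hk by exact Hmu.
  assert (Hb := Cmod_ge_0 b).
  assert (Hrho : forall rho, 0 < rho < 1 -> Cmod b * rho ^ pred n <= C_n n alpha).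
  { intros rho Hr. set (z := (rho * Cconj u)%C).
    assert (Hz : Cmod z = rho).
    { unfold z. rewrite Cmod_mult, Cmod_R, Cmod_conj, Hu, Rabs_right; lra. }
    assert (Hz0 : z <> 0%C) by (apply Cmod_gt_0; lra).
    specialize (Hpos z Hz0 ltac:(lra)).
    rewrite radial_form_spiral, Hre, Hz in Hpos by exact Hn.
    replace (b * Cconj z ^ S n * (mu - INR n * Cconj mu))%C
      with (RtoC (rho ^ S n) * RtoC (- (Cmod b * spiral_modulus n s)))%C in Hpos.
    2:{ rewrite <- Hk. unfold z. rewrite Cmult_conj, Cconj_conj, Cpow_mult_l, RtoC_pow.
        replace (Cconj rho) with (RtoC rho)
          by (unfold Cconj, RtoC; simpl; f_equal; ring).
        ring. }
    rewrite <- RtoC_mult in Hpos. simpl Re in Hpos.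
    set (x := Cmod b * rho ^ pred n).
    apply (C_n_root n alpha x Hn Ha).
    { apply Rmult_le_pos; [exact Hb|]. apply pow_le; lra. }
    fold s. apply (Rmult_le_reg_l (rho ^ 2)); [apply pow_lt; lra|].
    rewrite Rmult_0_r. eapply Rle_trans; [exact Hpos|]. apply Req_le.
    unfold x. destruct n as [|n]; [lia|]. simpl. ring. }
  apply Rnot_lt_le. intros Hlt.
  assert (Hc : continuity_pt (fun rho => Cmod b * rho ^ pred n) 1).
  { apply derivable_continuous_pt. auto_derive; trivial. }
  destruct (Hc (Cmod b - C_n n alpha)) as [d [Hd Hcd]]; [lra|].
  set (rho := 1 - Rmin (1 / 2) (d / 2)).
  assert (Hm : 0 < Rmin (1 / 2) (d / 2) <= 1 / 2)
    by (split; [apply Rmin_pos; lra|apply Rmin_l]).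
  assert (Hm2 : Rmin (1 / 2) (d / 2) <= d / 2) by apply Rmin_r.
  specialize (Hrho rho ltac:(unfold rho; lra)).
  specialize (Hcd rho). simpl in Hcd. unfold R_dist in Hcd.
  rewrite pow1, Rmult_1_r in Hcd.
  assert (H : Rabs (Cmod b * rho ^ pred n - Cmod b) < Cmod b - C_n n alpha).
  { apply Hcd. split; [split; [exact I|unfold rho; lra]|].
    unfold rho. rewrite Rabs_left; lra. }
  apply Rabs_lt_between in H. lra.
Qed.

(** * Harmonicity and the Jacobian *)

(** The real harmonic polynomials [Re (c conj(z)^m)] are closed under both
    partial derivatives; since [Im w = Re (- i w)], they also cover imaginary
    parts. *)
Definition conj_monomial (c : C) (m : nat) (z : C) : R := Re (c * Cconj z ^ m).

Lemma conj_monomial_S (c : C) (m : nat) (z : C) :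
  conj_monomial c (S m) z
  = Re z * conj_monomial c m z + Im z * conj_monomial (- Ci * c) m z.
Proof.
  unfold conj_monomial. simpl Cpow. set (p := (Cconj z ^ m)%C).
  destruct z, c, p; unfold Cmult, Copp, Cconj, Ci, Re, Im; simpl. ring.
Qed.

Lemma conj_monomial_derivative_S (c : C) (m : nat) (z : C) :
  conj_monomial (INR (S m) * c) m z
  = conj_monomial c m z + (Re z * conj_monomial (INR m * c) (pred m) z
                           + Im z * conj_monomial (INR m * (- Ci * c)) (pred m) z).
Proof.
  rewrite S_INR, RtoC_plus. destruct m as [|m].
  - unfold conj_monomial, Cmult, Cplus, RtoC, Re, Im; simpl. ring.
  - replace (INR (S m) * (- Ci * c))%C with (- Ci * (INR (S m) * c))%C by ring.
    change (pred (S m)) with m. rewrite <- conj_monomial_S.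
    unfold conj_monomial.
    match goal with |- _ = Re ?x + Re ?y => change (Re x + Re y) with (Re (x + y)%C) end.
    f_equal. ring.
Qed.

Lemma is_derive_linear_comb (f g : R -> R) (x y df dg : R) :
  is_derive f x df -> is_derive g x dg ->
  is_derive (fun t => t * f t + y * g t) x (f x + (x * df + y * dg)).
Proof.
  intros Hf Hg. auto_derive.
  - split; [now exists df|split; [now exists dg|trivial]].
  - change (Derive (fun t => f t) x) with (Derive f x).
    change (Derive (fun t => g t) x) with (Derive g x).
    rewrite (is_derive_unique f x df Hf), (is_derive_unique g x dg Hg). ring.
Qed.

Lemma conj_monomial_derive_x (c : C) (m : nat) (x y : R) :
  is_derive (fun t => conj_monomial c m (t, y)) x
    (conj_monomial (INR m * c) (pred m) (x, y)).
Proof.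
  revert c. induction m as [|m IH]; intros c.
  - replace (conj_monomial (INR 0 * c) (pred 0) (x, y)) with 0
      by (unfold conj_monomial, Cmult, RtoC, Re; simpl; ring).
    apply (is_derive_ext (fun _ => Re (c * 1))); [reflexivity|].
    exact (is_derive_const (K := R_AbsRing) (V := R_NormedModule) _ _).
  - apply (is_derive_ext (fun t => t * conj_monomial c m (t, y)
                                   + y * conj_monomial (- Ci * c) m (t, y))).
    { intros t. now rewrite conj_monomial_S. }
    change (pred (S m)) with m. rewrite conj_monomial_derivative_S.
    assert (H1 := IH c). assert (H2 := IH (- Ci * c)%C).
    exact (is_derive_linear_comb _ _ x y _ _ H1 H2).
Qed.

Lemma conj_monomial_derive_y (c : C) (m : nat) (x y : R) :
  is_derive (fun t => conj_monomial c m (x, t)) y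
    (conj_monomial (INR m * (- Ci * c)) (pred m) (x, y)).
Proof.
  revert c. induction m as [|m IH]; intros c.
  - replace (conj_monomial (INR 0 * (- Ci * c)) (pred 0) (x, y)) with 0
      by (unfold conj_monomial, Cmult, RtoC, Re; simpl; ring).
    apply (is_derive_ext (fun _ => Re (c * 1))); [reflexivity|].
    exact (is_derive_const (K := R_AbsRing) (V := R_NormedModule) _ _).
  - apply (is_derive_ext (fun t => t * conj_monomial (- Ci * c) m (x, t)
                                   + x * conj_monomial c m (x, t))).
    { intros t. rewrite conj_monomial_S. apply Rplus_comm. }
    change (pred (S m)) with m. rewrite conj_monomial_derivative_S.
    assert (H1 := IH c). assert (H2 := IH (- Ci * c)%C).
    evar_last; [exact (is_derive_linear_comb _ _ y x _ _ H2 H1)|].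
    change (Re (x, y)) with x. change (Im (x, y)) with y.
    apply Rplus_eq_compat_l, Rplus_comm.
Qed.

Lemma conj_monomial_continuous (c : C) (m : nat) (z : C) :
  continuous (conj_monomial c m) z.
Proof.
  revert c. induction m as [|m IH]; intros c.
  - apply continuous_const.
  - apply (continuous_ext (fun w : C => Re w * conj_monomial c m w
                                    + Im w * conj_monomial (- Ci * c) m w)).
    { intros w. now rewrite conj_monomial_S. }
    apply (continuous_plus (K := R_AbsRing) (V := R_NormedModule));
      apply (continuous_mult (K := R_AbsRing)).
    + apply continuous_fst.
    + apply IH.
    + apply continuous_snd.
    + apply IH.
Qed.

Definition conj_binomial (c : C) (m : nat) (d : C) (k : nat) (z : C) : R :=
  conj_monomial c m z + conj_monomial d k z.

Lemma conj_binomial_derive_x (c : C) (m : nat) (d : C) (k : nat) (x y : R) :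
  is_derive (fun t => conj_binomial c m d k (t, y)) x
    (conj_binomial (INR m * c) (pred m) (INR k * d) (pred k) (x, y)).
Proof.
  apply (is_derive_plus (K := R_AbsRing) (V := R_NormedModule)
           (fun t => conj_monomial c m (t, y)) (fun t => conj_monomial d k (t, y)));
    apply conj_monomial_derive_x.
Qed.

Lemma conj_binomial_derive_y (c : C) (m : nat) (d : C) (k : nat) (x y : R) :
  is_derive (fun t => conj_binomial c m d k (x, t)) y
    (conj_binomial (INR m * (- Ci * c)) (pred m) (INR k * (- Ci * d)) (pred k) (x, y)).
Proof.
  apply (is_derive_plus (K := R_AbsRing) (V := R_NormedModule)
           (fun t => conj_monomial c m (x, t)) (fun t => conj_monomial d k (x, t)));
    apply conj_monomial_derive_y.
Qed.

Lemma partial_x_conj_binomial (c : C) (m : nat) (d : C) (k : nat) :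
  partial_x (conj_binomial c m d k)
  = conj_binomial (INR m * c) (pred m) (INR k * d) (pred k).
Proof.
  apply functional_extensionality. intros [x y]. unfold partial_x.
  apply is_derive_unique, conj_binomial_derive_x.
Qed.

Lemma partial_y_conj_binomial (c : C) (m : nat) (d : C) (k : nat) :
  partial_y (conj_binomial c m d k)
  = conj_binomial (INR m * (- Ci * c)) (pred m) (INR k * (- Ci * d)) (pred k).
Proof.
  apply functional_extensionality. intros [x y]. unfold partial_y.
  apply is_derive_unique, conj_binomial_derive_y.
Qed.

Lemma conj_binomial_C1 (D : C -> Prop) (c : C) (m : nat) (d : C) (k : nat) :
  C1_on D (conj_binomial c m d k).
Proof.
  assert (Hc : forall c m d k z, continuous (conj_binomial c m d k) z).
  { intros. apply (continuous_plus (K := R_AbsRing) (V := R_NormedModule)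
             (conj_monomial _ _) (conj_monomial _ _));
      apply conj_monomial_continuous. }
  intros [x y] _. rewrite partial_x_conj_binomial, partial_y_conj_binomial.
  split; [eexists; apply conj_binomial_derive_x|].
  split; [eexists; apply conj_binomial_derive_y|].
  split; apply Hc.
Qed.

(** The two second derivatives differ by the factor [(- i)^2 = - 1]. *)
Lemma conj_binomial_harmonic (D : C -> Prop) (c : C) (m : nat) (d : C) (k : nat) :
  real_harmonic_on D (conj_binomial c m d k).
Proof.
  unfold real_harmonic_on, C2_on.
  rewrite partial_x_conj_binomial, partial_y_conj_binomial.
  split; [split; [|split]; apply conj_binomial_C1|].
  intros z _. rewrite partial_x_conj_binomial, partial_y_conj_binomial.
  unfold conj_binomial.
  assert (H : forall (a e : C) j, a = (- e)%C ->
            conj_monomial a j z = - conj_monomial e j z).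
  { intros a e j ->. unfold conj_monomial, Cmult, Copp, Re; simpl. ring. }
  assert (Hi : (Ci * Ci = - (1))%C)
    by (unfold Ci, Cmult, Copp, RtoC; simpl; f_equal; ring).
  assert (H2 : forall (e : C) j k,
            (INR k * (- Ci * (INR j * (- Ci * e))) = - (INR k * (INR j * e)))%C).
  { intros e j l. transitivity (INR l * (INR j * e) * (Ci * Ci))%C; [ring|].
    rewrite Hi. ring. }
  rewrite (H _ _ _ (H2 c m (pred m))), (H _ _ _ (H2 d k (pred k))). ring.
Qed.

Lemma Re_f_bn (b : C) (n : nat) :
  (fun z => Re (f_bn b n z)) = conj_binomial 1 1 b n.
Proof.
  apply functional_extensionality. intros [x y].
  unfold conj_binomial, conj_monomial, f_bn. set (p := (b * _)%C).
  unfold Cmult, Cplus, Cconj, RtoC, Re; simpl. ring.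
Qed.

Lemma Im_f_bn (b : C) (n : nat) :
  (fun z => Im (f_bn b n z)) = conj_binomial Ci 1 (- Ci * b) n.
Proof.
  apply functional_extensionality. intros [x y].
  unfold conj_binomial, conj_monomial, f_bn.
  rewrite <- (Cmult_assoc (- Ci) b). set (p := (b * _)%C).
  unfold Cmult, Cplus, Cconj, Copp, Ci, RtoC, Re, Im; simpl. ring.
Qed.

Lemma f_bn_derivatives (b : C) (n : nat) (z : C) :
  f_z (f_bn b n) z = 1%C /\
  f_zbar (f_bn b n) z = (INR n * b * Cconj z ^ pred n)%C.
Proof.
  assert (Hx : f_x (f_bn b n) z = (1 + INR n * b * Cconj z ^ pred n)%C).
  { unfold f_x. rewrite Re_f_bn, Im_f_bn, !partial_x_conj_binomial.
    unfold conj_binomial, conj_monomial.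
    replace (INR n * (- Ci * b) * Cconj z ^ pred n)%C
      with (- Ci * (INR n * b * Cconj z ^ pred n))%C by ring.
    set (p := (_ * Cconj z ^ pred n)%C). destruct p as [p1 p2].
    unfold Cmult, Cplus, Copp, Ci, RtoC, Re; simpl. f_equal; ring. }
  assert (Hy : f_y (f_bn b n) z = (Ci * (1 - INR n * b * Cconj z ^ pred n))%C).
  { unfold f_y. rewrite Re_f_bn, Im_f_bn, !partial_y_conj_binomial.
    unfold conj_binomial, conj_monomial.
    replace (INR n * (- Ci * (- Ci * b)) * Cconj z ^ pred n)%C
      with (- Ci * (- Ci * (INR n * b * Cconj z ^ pred n)))%C by ring.
    replace (INR n * (- Ci * b) * Cconj z ^ pred n)%C
      with (- Ci * (INR n * b * Cconj z ^ pred n))%C by ring.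
    set (p := (INR n * b * Cconj z ^ pred n)%C). destruct p as [p1 p2].
    unfold Cmult, Cplus, Cminus, Copp, Ci, RtoC, Re; simpl. f_equal; ring. }
  assert (Hi : (Ci * Ci = - (1))%C)
    by (unfold Ci, Cmult, Copp, RtoC; simpl; f_equal; ring).
  assert (H2 : RtoC 2 <> 0%C) by (intros H; apply RtoC_inj in H; lra).
  unfold f_z, f_zbar. rewrite Hx, Hy, Cmult_assoc, Hi. split; field; exact H2.
Qed.

Lemma f_bn_class_H0 (b : C) (n : nat) : (1 <= n)%nat -> class_H0 (f_bn b n).
Proof.
  intros Hn. split; [|split].
  - split; [rewrite Re_f_bn|rewrite Im_f_bn]; apply conj_binomial_harmonic.
  - unfold f_bn. destruct n as [|n]; [lia|].
    replace (Cconj 0) with (RtoC 0)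
      by (unfold Cconj, RtoC; simpl; f_equal; ring).
    simpl. ring.
  - apply f_bn_derivatives.
Qed.

Lemma f_bn_jacobian (b : C) (n : nat) (z : C) :
  jacobian (f_bn b n) z = 1 - (INR n * Cmod b * Cmod z ^ pred n) ^ 2.
Proof.
  unfold jacobian. destruct (f_bn_derivatives b n z) as [-> ->].
  rewrite Cmod_1, !Cmod_mult, Cmod_pow, Cmod_conj, Cmod_R, Rabs_right; [ring|].
  apply Rle_ge, pos_INR.
Qed.

(** * Univalence and images of disks *)

Lemma f_bn_orientation_preserving (b : C) (n : nat) :
  INR n * Cmod b < 1 -> orientation_preserving (f_bn b n).
Proof.
  intros Hq z Hz. unfold disk in Hz. rewrite f_bn_jacobian.
  assert (Hq0 : 0 <= INR n * Cmod b)
    by (apply Rmult_le_pos; [apply pos_INR|apply Cmod_ge_0]).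
  assert (Hp := pow_le_1 (Cmod z) (pred n) (conj (Cmod_ge_0 z) (Rlt_le _ _ Hz))).
  assert (0 <= INR n * Cmod b * Cmod z ^ pred n < 1) by (split; nra). nra.
Qed.

Lemma f_bn_univalent (b : C) (n : nat) :
  INR n * Cmod b < 1 -> univalent (f_bn b n).
Proof.
  intros Hq z w Hz Hw H. unfold disk in Hz, Hw.
  assert (L := f_bn_lower_lipschitz b n 1 z w ltac:(lra) ltac:(lra)).
  rewrite H, pow1, Rmult_1_r in L.
  replace (f_bn b n w - f_bn b n w)%C with (RtoC 0) in L by ring.
  rewrite Cmod_0 in L. assert (H0 := Cmod_ge_0 (z - w)).
  assert (E : Cmod (z - w) = 0) by nra. apply Cmod_eq_0 in E.
  replace z with (z - w + w)%C by ring. rewrite E. ring.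
Qed.

Lemma f_bn_0 (b : C) (n : nat) : (1 <= n)%nat -> f_bn b n 0 = 0%C.
Proof. intros Hn. apply (f_bn_class_H0 b n Hn). Qed.

(** Every [w] near [f z0] is solved for by the contraction principle started at
    [z0]. *)
Lemma f_bn_image_open (b : C) (n : nat) (r : R) :
  INR n * Cmod b < 1 -> r <= 1 -> open (image (f_bn b n) (disk r)).
Proof.
  intros Hq Hr. apply open_Cmod. intros w [z0 [Hz0 ->]]. unfold disk in Hz0.
  exists ((1 - INR n * Cmod b) * (r - Cmod z0)).
  split; [apply Rmult_lt_0_compat; lra|]. intros w Hw.
  assert (Hw' : Cmod (w - f_bn b n z0) / (1 - INR n * Cmod b) < r - Cmod z0).
  { apply Rlt_div_l; lra. }
  destruct (f_bn_solve b n z0 w Hq ltac:(lra)) as [z [Hz <-]].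
  exists z. split; [|reflexivity]. unfold disk.
  assert (H := Cmod_triangle (z - z0) z0).
  replace (z - z0 + z0)%C with z in H by ring. lra.
Qed.

Lemma f_bn_segment_continuous (b : C) (n : nat) (z : C) (t : R) :
  continuous (fun s : R => f_bn b n (s * z)) t.
Proof.
  assert (H : forall (c : C) m, continuous (fun s : R => conj_monomial c m (s * z)) t).
  { intros c m. apply (continuous_ext (fun s : R => s ^ m * Re (c * Cconj z ^ m))).
    - intros s. unfold conj_monomial. rewrite Cmult_conj, Cpow_mult_l.
      replace (Cconj s) with (RtoC s)
        by (unfold Cconj, RtoC; simpl; f_equal; ring).
      rewrite <- RtoC_pow. set (p := (Cconj z ^ m)%C).
      unfold Cmult, RtoC, Re; simpl. ring.
    - apply (continuous_mult (K := R_AbsRing)); [|apply continuous_const].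
      apply (ex_derive_continuous (K := R_AbsRing) (V := R_NormedModule)).
      auto_derive; trivial. }
  assert (Hb : forall c m d k,
            continuous (fun s : R => conj_binomial c m d k (s * z)) t).
  { intros. apply (continuous_plus (K := R_AbsRing) (V := R_NormedModule)
             (fun s : R => conj_monomial c m (s * z)) (fun s : R => conj_monomial d k (s * z)));
      apply H. }
  assert (H1 : continuous (fun s : R => Re (f_bn b n (s * z))) t).
  { eapply continuous_ext; [|apply (Hb 1%C 1%nat b n)].
    intros s. now rewrite <- Re_f_bn. }
  assert (H2 : continuous (fun s : R => Im (f_bn b n (s * z))) t).
  { eapply continuous_ext; [|apply (Hb Ci 1%nat (- Ci * b)%C n)].
    intros s. now rewrite <- Im_f_bn. }
  now apply continuous_of_Re_Im.
Qed.

Lemma f_bn_image_domain (b : C) (n : nat) (r : R) :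
  INR n * Cmod b < 1 -> 0 < r <= 1 -> Defs.domain (image (f_bn b n) (disk r)).
Proof.
  intros Hq Hr. split; [|split].
  - exists (f_bn b n 0), (RtoC 0). split; [|reflexivity].
    unfold disk. rewrite Cmod_0. lra.
  - now apply f_bn_image_open.
  - apply (connected_of_paths _ (f_bn b n 0)). intros w [z [Hz ->]].
    unfold disk in Hz. exists (fun t => f_bn b n (t * z)).
    split; [|split; f_equal; ring].
    intros t Ht. split; [apply f_bn_segment_continuous|].
    exists (t * z)%C. split; [|reflexivity]. unfold disk.
    rewrite Cmod_mult, Cmod_R, Rabs_right by lra.
    assert (H := Cmod_ge_0 z). nra.
Qed.

(** * The equivalence *)

Lemma spiral_direction (alpha : R) :
  Cexp (Ci * RtoC (PI * (1 - alpha) / 2))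
  = (sin (PI * alpha / 2), cos (PI * alpha / 2)).
Proof.
  replace (Ci * RtoC (PI * (1 - alpha) / 2))%C
    with ((0, PI / 2 - PI * alpha / 2) : C).
  - unfold Cexp; simpl. now rewrite exp_0, cos_shift, sin_shift, !Rmult_1_l.
  - unfold Ci, Cmult, RtoC; simpl. f_equal; field.
Qed.

Lemma Cmod_direction_1 (x c : R) : Rabs c = Rabs (cos x) ->
  Cmod (sin x, c) = 1.
Proof.
  intros H. unfold Cmod; simpl. transitivity (sqrt 1); [f_equal|apply sqrt_1].
  assert (H2 := sin2_cos2 x). apply Rsqr_eq_asb_1 in H. unfold Rsqr in *. lra.
Qed.

Lemma sin_cos_pos (alpha : R) : 0 < alpha < 1 ->
  0 < sin (PI * alpha / 2) /\ 0 < cos (PI * alpha / 2).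
Proof.
  intros Ha. assert (Hpi := PI_RGT_0).
  split; [apply sin_gt_0; nra|apply cos_gt_0; nra].
Qed.

(** A point of the region is reached from [1] by following first one and then
    the other of the two spirals inwards; both directions [(s, c)] and
    [(s, - c)] have the same real part, hence leave the images of the disks
    invariant under the same bound. *)
Lemma SS_H_of_bound (alpha : R) (b : C) (n : nat) :
  0 < alpha < 1 -> (1 <= n)%nat -> Cmod b <= C_n n alpha ->
  SS_H alpha (f_bn b n).
Proof.
  intros Ha Hn Hb. assert (Hb0 := Cmod_ge_0 b).
  assert (Hq : INR n * Cmod b < 1).
  { eapply Rle_lt_trans; [|apply (C_n_lt_inv n alpha Hn Ha)].
    apply Rmult_le_compat_l; [apply pos_INR|exact Hb]. }
  split; [now apply f_bn_class_H0|].
  split; [now apply f_bn_orientation_preserving|].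
  split; [now apply f_bn_univalent|].
  intros r Hr. split; [apply f_bn_image_domain; [exact Hq|lra]|].
  intros w0 Hw0 w HV.
  destruct (sin_cos_pos alpha Ha) as [Hs Hc].
  set (s := sin (PI * alpha / 2)) in *. set (c := cos (PI * alpha / 2)) in *.
  assert (Hinv : forall c', Rabs c' = Rabs c -> forall T v, 0 <= T ->
            image (f_bn b n) (disk r) v ->
            image (f_bn b n) (disk r) (v * Cexp (- T * (s, c')))%C).
  { intros c' Hc' T v HT Hv.
    assert (Hm : Cmod (s, c') = 1) by now apply Cmod_direction_1.
    apply spiral_invariance; trivial; [lra|].
    intros z Hz. now apply (radial_form_nonneg b n alpha). }
  destruct (V_polar_form alpha w Ha HV) as [->|[x [t [-> Hxt]]]].
  - exists (RtoC 0). split; [unfold disk; rewrite Cmod_0; lra|].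
    rewrite f_bn_0 by exact Hn. ring.
  - assert (Ht : Rabs (t / c) <= - x / s).
    { rewrite Rabs_div, (Rabs_right c) by lra.
      apply (proj1 (Rle_div_r (Rabs t / c) (- x) s Hs)).
      replace (Rabs t / c * s) with (tan (PI * alpha / 2) * Rabs t)
        by (unfold tan; fold s c; field; lra). lra. }
    apply Rabs_le_between in Ht.
    (* [- (T1 + T2) s = x] and [(T1 - T2) c = t] *)
    set (T1 := (- x / s + t / c) / 2). set (T2 := (- x / s - t / c) / 2).
    assert (H := Hinv (- c) (Rabs_Ropp c) T1 _ ltac:(unfold T1; lra)
                   (Hinv c eq_refl T2 w0 ltac:(unfold T2; lra) Hw0)).
    replace (w0 * Cexp (x, t))%C with
      (w0 * Cexp (- T2 * (s, c)) * Cexp (- T1 * (s, (- c)%R)))%C; [exact H|].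
    rewrite <- Cmult_assoc, <- Cexp_add. do 2 f_equal.
    unfold T1, T2, Cplus, Cmult, Copp, RtoC; simpl. f_equal; field; lra.
Qed.

(** The closed spiral arc consists of boundary points of the region, or of
    interior points once it has made more than half a turn; after contraction by
    [exp (- eps)] it lies in the region, and [exp eps * w0] still lies in the
    open image. *)
Lemma SP_H_of_SS_H (alpha : R) (f : C -> C) : 0 < alpha < 1 ->
  SS_H alpha f -> SP_H (PI * (1 - alpha) / 2) f.
Proof.
  intros Ha [H0 [Hor [Hun HS]]]. split; [exact H0|]. split; [exact Hor|].
  split; [exact Hun|]. intros r Hr. destruct (HS r Hr) as [Hdom Hstar].
  split; [exact Hdom|]. intros w0 Hw0 Hne v [[t [Ht ->]]| ->].
  2:{ replace (RtoC 0) with (w0 * 0)%C by ring. apply Hstar; [exact Hw0|].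
      apply V_of_spiral_height; [exact Ha|now left]. }
  rewrite spiral_direction.
  destruct (sin_cos_pos alpha Ha) as [Hs Hc].
  destruct Hdom as [_ [Hopen _]].
  set (Om := image f (disk r)) in *.
  destruct (proj1 (open_Cmod Om) Hopen w0 Hw0) as [e [He Hball]].
  assert (Hm : 0 < Cmod w0) by now apply Cmod_gt_0.
  set (eps := Rmin (1 / 2) (e / (8 * Cmod w0))).
  assert (Heps : 0 < eps) by (apply Rmin_pos; [lra|apply Rdiv_lt_0_compat; lra]).
  assert (Heps1 : eps <= 1 / 2) by apply Rmin_l.
  assert (Heps2 : eps <= e / (8 * Cmod w0)) by apply Rmin_r.
  (* [- eps * (- 1)], the exponent of a step in the direction [- 1], is [eps] *)
  assert (Hw1 : Om (w0 * Cexp (- eps * (- (1))))%C).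
  { apply Hball. eapply Rle_lt_trans.
    - apply spiral_displacement; [rewrite Cmod_opp, Cmod_1; lra|lra].
    - apply (Rmult_le_compat_l (8 * Cmod w0)) in Heps2; [|lra].
      replace (8 * Cmod w0 * (e / (8 * Cmod w0))) with e in Heps2 by (field; lra).
      nra. }
  set (x := t * sin (PI * alpha / 2) - eps). set (th := t * cos (PI * alpha / 2)).
  replace (w0 * Cexp (t * (sin (PI * alpha / 2), cos (PI * alpha / 2))))%C
    with (w0 * Cexp (- eps * (- (1))) * Cexp (x, th))%C.
  2:{ rewrite <- Cmult_assoc, <- Cexp_add. do 2 f_equal.
      unfold x, th, Cplus, Cmult, Copp, RtoC; simpl. f_equal; ring. }
  apply Hstar; [exact Hw1|]. apply V_of_spiral_height; [exact Ha|right].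
  split; [apply Cexp_neq_0|]. rewrite spiral_height_Cexp.
  assert (Htan := tan_pos alpha Ha). assert (Hac := acos_cos_abs th).
  assert (Hth : Rabs th = - th) by (apply Rabs_left1; unfold th; nra).
  assert (Htt : tan (PI * alpha / 2) * Rabs th = - (t * sin (PI * alpha / 2))).
  { rewrite Hth. unfold th, tan. field. lra. }
  assert (tan (PI * alpha / 2) * acos (cos th) <= tan (PI * alpha / 2) * Rabs th)
    by (apply Rmult_le_compat_l; lra).
  unfold x. lra.
Qed.

(** Positivity of the Jacobian at the points of modulus [rho < 1] provides the
    lower Lipschitz constants. *)
Lemma bound_of_SP_H (alpha : R) (b : C) (n : nat) :
  0 < alpha < 1 -> (1 <= n)%nat ->
  SP_H (PI * (1 - alpha) / 2) (f_bn b n) -> Cmod b <= C_n n alpha.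
Proof.
  intros Ha Hn [_ [Hor [Hun HS]]].
  set (mu := (sin (PI * alpha / 2), cos (PI * alpha / 2)) : C).
  assert (Hmu : Cmod mu = 1) by now apply Cmod_direction_1.
  apply (bound_of_radial_form b n alpha mu Hn Ha Hmu eq_refl).
  intros z Hz0 Hz. apply radial_form_of_spirals; [|lra|exact Hz|].
  - intros rho Hrho. assert (Hm : Cmod (RtoC rho) = rho)
      by (rewrite Cmod_R; apply Rabs_right; lra).
    assert (HJ := Hor (RtoC rho)). rewrite f_bn_jacobian, Hm in HJ.
    unfold disk in HJ. rewrite Hm in HJ. specialize (HJ ltac:(lra)).
    apply Rnot_le_lt. intros H. nra.
  - intros r s Hr Hs. assert (Hr0 := Cmod_ge_0 z).
    destruct (HS r ltac:(lra)) as [_ Hsp].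
    apply (Hsp (f_bn b n z)).
    + exists z. split; [unfold disk; lra|reflexivity].
    + intros H. apply Hz0, Hun; [exact Hz|unfold disk; rewrite Cmod_0; lra|].
      now rewrite f_bn_0.
    + left. exists (- s). split; [lra|]. rewrite spiral_direction. fold mu.
      now rewrite RtoC_opp.
Qed.

Theorem proposition4p5 (alpha : R) (halpha : 0 < alpha < 1)
  (b : C) (n : nat) (hn : (1 <= n)%nat) :
  let lambda := PI * (1 - alpha) / 2 in
  (SS_H alpha (f_bn b n) <-> SP_H lambda (f_bn b n)) /\
  (SP_H lambda (f_bn b n) <-> Cmod b <= C_n n alpha).
Proof.
  intros lambda.
  assert (H1 := SP_H_of_SS_H alpha (f_bn b n) halpha).
  assert (H2 := bound_of_SP_H alpha b n halpha hn).
  assert (H3 := SS_H_of_bound alpha b n halpha hn).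
  fold lambda in H1, H2. tauto.
Qed.
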